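(* Let $e^{-f_t}$ and $e^{-g_t}$ be log-concave probability densities on $\mathbb R^{n_x}$ and $\mathbb R^{n_z}$ respectively, for $t=0,\dots,T$, and assume that all $f_t$ and $g_t$ are convex and piecewise linear-quadratic. Let $F_0,\dots,F_{T-1}$ be real $n_x\times n_x$ matrices, $H_0,\dots,H_T$ real $n_z\times n_x$ matrices, and $z_0,\dots,z_T\in\mathbb R^{n_z}$. Consider the estimation problem $$(\mathcal P)\quad \min_{x_0,\dots,x_T}\ \sum_{t=0}^T f_t(w_t)+\sum_{t=0}^T g_t(z_t-H_tx_t)\quad\text{s.t. } x_{t+1}=F_tx_t+w_{t+1}\ (t=0,\dots,T-1),\ \ x_0=w_0,$$ and the control problem $$(\mathcal D)\quad \sup_{u_0,\dots,u_T}\ \sum_{t=0}^T\big(z_t'u_t-f_t^*(y_t)-g_t^*(u_t)\big)\quad\text{s.t. } y_t=F_t'y_{t+1}+H_t'u_t\ (t=0,\dots,T-1),\ \ y_T=H_T'u_T .$$ If either $(\mathcal P)$ or $(\mathcal D)$ is feasible, then strong duality holds between them, that is, their optimal objective values are equal. Furthermore, both problems attain their optimal objective values.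
   Context: Prime denotes transpose; $h^*(y)=\sup_x\{\langle x,y\rangle-h(x)\}$ is the convex conjugate. A log-concave density has the form $e^{-f}$ with $f$ convex with values in $(-\infty,\infty]$ and $e^{-\infty}=0$; by convention each $f_t$ and $g_t$ is taken to be its lower semicontinuous version. A function $h:\mathbb R^n\to(-\infty,\infty]$ is piecewise linear-quadratic if its domain (the set where it is finite) is a union of finitely many polyhedral sets, on each of which $h$ is given by a polynomial of degree at most two. In $(\mathcal P)$, $w_0,\dots,w_T\in\mathbb R^{n_x}$ are determined by $x_0,\dots,x_T\in\mathbb R^{n_x}$ through the constraints; in $(\mathcal D)$, $y_0,\dots,y_T\in\mathbb R^{n_x}$ are determined by $u_0,\dots,u_T\in\mathbb R^{n_z}$ through the constraints. A problem is feasible if some point satisfies its constraints with finite objective value.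
   Formalization: Attainment of (D) is claimed only when its optimal value is finite: if (P) is infeasible, (D) is still feasible (u=0) but its value is +∞, which no u attains (e.g. T=0, f_0=g_0 the indicator of [0,1], H_0=1, z_0=10). *)

(* Defs.v *)
From HB Require Import structures.
From mathcomp Require Import all_boot all_order all_algebra.
From mathcomp Require Import all_classical all_reals all_analysis.

Set Implicit Arguments.
Unset Strict Implicit.
Unset Printing Implicit Defensive.

Import Order.TTheory GRing.Theory Num.Theory.
Import numFieldNormedType.Exports.

Local Open Scope classical_set_scope.
Local Open Scope ring_scope.

(** * Lebesgue measure on R^n

    The library provides the product sigma-algebra on [n.-tuple R] but no
    n-fold product measure.  The measure on R^n.+1 is the image of the product
    of the measures on R and on R^n under [(x, v) |-> x :: v]. *)

Section lebesgue_step.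
Local Open Scope ereal_scope.
Context {R : realType} (n : nat).
Let T := measurableTypeR R.
Variable mu : {sigma_finite_measure set (n.-tuple T) -> \bar R}.

Definition tcons (p : T * n.-tuple T) : n.+1.-tuple T :=
  [tuple of p.1 :: p.2].

Lemma measurable_tcons : measurable_fun setT tcons.
Proof. exact: (@measurable_cons _ _ _ _ fst n snd). Qed.

Definition lebesgue_step : set (n.+1.-tuple T) -> \bar R :=
  pushforward (@lebesgue_measure R \x mu) tcons.

Let lebesgue_step0 : lebesgue_step set0 = 0.
Proof. by rewrite /lebesgue_step /pushforward preimage_set0 measure0. Qed.

Let lebesgue_step_ge0 A : 0 <= lebesgue_step A.
Proof. exact: (measure_ge0 (@lebesgue_measure R \x mu)). Qed.

Let lebesgue_step_sigma_additive : semi_sigma_additive lebesgue_step.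
Proof.
move=> F mF tF mUF; apply: measure_semi_sigma_additive => //.
exact: measurable_tcons.
Qed.

HB.instance Definition _ := isMeasure.Build _ _ _ lebesgue_step
  lebesgue_step0 lebesgue_step_ge0 lebesgue_step_sigma_additive.

Definition tuncons (v : n.+1.-tuple T) : T * n.-tuple T :=
  (thead v, [tuple of behead v]).

Lemma tconsK : cancel tcons tuncons.
Proof.
by move=> [a v]; rewrite /tuncons /tcons; congr (_, _); apply/val_inj.
Qed.

Lemma measurable_tuncons : measurable_fun setT tuncons.
Proof.
apply/measurable_fun_pairP; split.
  exact: measurable_tnth.
exact: measurable_behead.
Qed.

Let lebesgue_step_sigma_finite : sigma_finite setT lebesgue_step.
Proof.
have /sigma_finiteP[F [TF ndF Foo]] := sigma_finiteT (@lebesgue_measure R).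
have /sigma_finiteP[G [TG ndG Goo]] := sigma_finiteT mu.
exists (fun k => tuncons @^-1` (F k `*` G k)).
  rewrite -preimage_bigcup (_ : \bigcup_k (F k `*` G k) = setT)//.
  apply/seteqP; split=> // -[x y] _.
  have [i _ Fix] : (\bigcup_i F i) x by rewrite -TF.
  have [k _ Gky] : (\bigcup_i G i) y by rewrite -TG.
  exists (maxn i k) => //; split => /=.
    by move: x Fix; exact/subsetPset/ndF/leq_maxl.
  by move: y Gky; exact/subsetPset/ndG/leq_maxr.
move=> k; have [mF Fk] := Foo k; have [mG Gk] := Goo k.
have mFG : measurable (F k `*` G k) by exact: measurableX.
split; first by rewrite -[X in measurable X]setTI; exact: measurable_tuncons.
rewrite /lebesgue_step /pushforward -comp_preimage.
rewrite (_ : tuncons \o tcons = id); last by apply/funext => p; exact: tconsK.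
by rewrite preimage_id product_measure1E// lte_mul_pinfty// ge0_fin_numE.
Qed.

HB.instance Definition _ := Measure_isSigmaFinite.Build _ _ _ lebesgue_step
  lebesgue_step_sigma_finite.

End lebesgue_step.

Fixpoint lebesgue_tuple (R : realType) (n : nat) :
    {sigma_finite_measure set (n.-tuple (measurableTypeR R)) -> \bar R} :=
  if n is m.+1 then lebesgue_step (lebesgue_tuple R m) else \d_ [tuple].

Lemma lebesgue_tuple_box (R : realType) (n : nat)
    (A : 'I_n -> set (measurableTypeR R)) : (forall i, measurable (A i)) ->
  lebesgue_tuple R n [set v | forall i, A i (tnth v i)] =
  (\prod_(i < n) lebesgue_measure (A i))%E.
Proof.
elim: n A => [|n IHn] A mA.
  by rewrite big_ord0 /= diracE mem_set// => -[].
rewrite big_ord_recl -(IHn (fun i => A (lift ord0 i)))//.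
rewrite -product_measure1E//=; last first.
  rewrite (_ : mkset _ = \bigcap_(i in [set: 'I_n])
      ((fun v : n.-tuple (measurableTypeR R) => tnth v i)
         @^-1` A (lift ord0 i))).
    apply: fin_bigcap_measurable => // i _.
    by rewrite -[X in measurable X]setTI; exact: measurable_tnth.
  by apply/seteqP; split=> v /= h i => [_|]; exact: h.
rewrite /lebesgue_step /pushforward; congr (_ _).
apply/seteqP; split=> -[x v] /=.
  move=> h; split => [|i]; first exact: (h ord0).
  by have := h (lift ord0 i); rewrite tnthS.
move=> [h0 h] i; case: (unliftP ord0 i) => [j|] ->; last exact: h0.
by rewrite tnthS; exact: h.
Qed.

(** * Convex functions on R^n with values in ]-oo, +oo] *)

Section functions.
Context {R : realType} {n : nat}.
Implicit Types (h : 'cV[R]_n -> \bar R) (C : set 'cV[R]_n).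

Definition dotp (x y : 'cV[R]_n) : R := (x^T *m y) 0 0.

Definition convex_efun h : Prop :=
  forall (x y : 'cV[R]_n) (s : R), 0 <= s <= 1 ->
    (h (s *: x + (1 - s) *: y)%R <= s%:E * h x + (1 - s)%:E * h y)%E.

Definition convex_conjugate h (y : 'cV[R]_n) : \bar R :=
  ereal_sup [set ((dotp x y)%:E - h x)%E | x in setT].

Definition dom h : set 'cV[R]_n := [set x | (h x < +oo)%E].

Definition polyhedral C : Prop :=
  exists (m : nat) (A : 'M[R]_(m, n)) (b : 'cV[R]_m),
    C = [set x | forall i, (A *m x) i 0 <= b i 0].

Definition piecewise_linear_quadratic h : Prop :=
  exists (N : nat) (C : 'I_N -> set 'cV[R]_n),
    [/\ forall k, polyhedral (C k),
        dom h = \bigcup_(k in setT) C k &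
        forall k, exists (Q : 'M[R]_n) (c : 'cV[R]_n) (d : R),
          forall x, C k x -> h x = (dotp x (Q *m x) + dotp c x + d)%:E].

(** [expeR (- h)] is a log-concave probability density, [h] being the lower
    semicontinuous version of its potential. *)
Definition log_concave_density h : Prop :=
  [/\ forall x, (-oo < h x)%E,
      convex_efun h,
      lower_semicontinuous h &
      (\int[lebesgue_tuple R n]_v expeR (- h (\col_i tnth v i)) = 1)%E].

End functions.

(** * The estimation and control problems

    The horizon is [T]: times [t = 0, ..., T] are elements of ['I_T.+1].  For
    [t : 'I_T], [now t] and [next t] are the times [t] and [t + 1]. *)

Definition now (T : nat) (t : 'I_T) : 'I_T.+1 := widen_ord (leqnSn T) t.
Definition next (T : nat) (t : 'I_T) : 'I_T.+1 := lift ord0 t.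

Section problems.
Context {R : realType} {nx nz T : nat}.
Variables (f : 'I_T.+1 -> 'cV[R]_nx -> \bar R).
Variables (g : 'I_T.+1 -> 'cV[R]_nz -> \bar R).
Variables (F : 'I_T -> 'M[R]_nx) (H : 'I_T.+1 -> 'M[R]_(nz, nx)).
Variable (z : 'I_T.+1 -> 'cV[R]_nz).
Implicit Types (x w y : 'I_T.+1 -> 'cV[R]_nx) (u : 'I_T.+1 -> 'cV[R]_nz).

Definition P_constraints x w : Prop :=
  (forall t : 'I_T, x (next t) = F t *m x (now t) + w (next t)) /\
  x ord0 = w ord0.

Definition P_objective x w : \bar R :=
  (\sum_(t < T.+1) f t (w t) + \sum_(t < T.+1) g t (z t - H t *m x t)%R)%E.

Definition P_feasible : Prop :=
  exists x w, P_constraints x w /\ P_objective x w \is a fin_num.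

Definition P_value : \bar R :=
  ereal_inf [set v | exists x w, P_constraints x w /\ v = P_objective x w].

Definition P_attained : Prop :=
  exists x w, P_constraints x w /\ P_objective x w = P_value.

Definition D_constraints u y : Prop :=
  (forall t : 'I_T,
     y (now t) = (F t)^T *m y (next t) + (H (now t))^T *m u (now t)) /\
  y ord_max = (H ord_max)^T *m u ord_max.

Definition D_objective u y : \bar R :=
  (\sum_(t < T.+1) ((dotp (z t) (u t))%:E
                    - convex_conjugate (f t) (y t)
                    - convex_conjugate (g t) (u t)))%E.

Definition D_feasible : Prop :=
  exists u y, D_constraints u y /\ D_objective u y \is a fin_num.

Definition D_value : \bar R :=
  ereal_sup [set v | exists u y, D_constraints u y /\ v = D_objective u y].

(** With proper [f] and [g] the objective never takes the value [+oo], so an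
    optimal value [+oo] (which occurs exactly when [(P)] is infeasible) is not
    attained. *)
Definition D_attained : Prop :=
  exists u y, D_constraints u y /\ D_objective u y = D_value.

End problems.

(* Main.v *)
Require Import Defs.
From HB Require Import structures.
From mathcomp Require Import all_boot all_order all_algebra.
From mathcomp Require Import all_classical all_reals all_analysis.
From mathcomp Require Import measurable_realfun ring lra.

(** All the functions are piecewise quadratic on polyhedra, so an infimum that is
    finite is attained (Frank-Wolfe), and at a minimiser Farkas' lemma on
    the tangent cones of the active pieces provides a subgradient orthogonal to
    the feasible subspace, i.e. a dual solution with the same value; no
    constraint qualification is needed.  Integrability enters only through the
    lower boundedness of the potentials: it rules out the value [-oo] for (P)
    and, when (P) is infeasible, it lets the normal of a hyperplane strictly
    separating the domain of the cost from the feasible subspace serve as a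
    direction along which the dual objective tends to [+oo]. *)

Set Implicit Arguments.
Unset Strict Implicit.
Unset Printing Implicit Defensive.

Import Order.TTheory GRing.Theory Num.Theory VectorInternalTheory.

Local Notation next := Defs.next.

Local Open Scope classical_set_scope.
Local Open Scope ring_scope.

(** * Farkas' lemma *)

Section farkas.
Context {R : realFieldType}.

(** Both problems are read as one Fenchel pair. In the space of all noises and residuals, (P)
    minimises a separable convex [cost] over an affine space, and the feasible points of (D) are
    exactly the linear forms that vanish on the direction of that space. The obstacle is that the
    affine space may touch the domain of [cost] only along its boundary, where a general separation
    argument can yield a normal to the domain instead of a subgradient. Polyhedrality removes it:
    near a point, each active piece coincides with its tangent cone, so that a subgradient is the
    solution of a finite linear system. Since domains may be unbounded, attainment comes from
    eliminating one coordinate at a time and not from compactness. In the infeasible case strictness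
    of the separation is essential: the dual objective grows along the ray at least at the rate of
    the gap, and a weak separation would allow the rate zero. *)

Lemma scalar_bundle (V : lmodType R) (l : V -> R) :
  scalar l -> exists l' : {scalar V}, l = l'.
Proof.
move=> hl.
pose l' : {scalar V} := HB.pack l (GRing.isLinear.Build _ _ _ _ l hl).
by exists l'.
Qed.

(** Induction on the number of constraints, valid in any module. If [j] is redundant its multiplier
    is 0; otherwise some [x0] satisfies the other constraints and has [0 < g x0], which forces
    [0 < a j x0]. *)
Lemma farkas_seq (V : lmodType R) (I : eqType) (r : seq I) (a : I -> V -> R)
    (g : V -> R) : uniq r -> (forall i, scalar (a i)) -> scalar g ->
    (forall x, (forall i, i \in r -> a i x <= 0) -> g x <= 0) ->
  exists2 c : I -> R, forall i, 0 <= c i &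
    forall x, g x = \sum_(i <- r) c i * a i x.
Proof.
elim: r a g => [|j r IHr] a g.
  move=> _ _ hg gle0; exists (fun=> 0) => // x; rewrite big_nil.
  have [g' eg] := scalar_bundle hg.
  apply/eqP; rewrite eq_le gle0// -oppr_le0 eg -linearN -eg; exact: gle0.
move=> /= /andP[jr ur] ha hg gle0.
have [[x0 [x0r gx0]]|nx0] :=
  pselect (exists x, (forall i, i \in r -> a i x <= 0) /\ 0 < g x); last first.
  have [c c0 gc] := IHr a g ur ha hg
    (fun x hx => ltac:(rewrite leNgt; apply/negP => gx; apply: nx0; by exists x)).
  exists (fun i => if i == j then 0 else c i) => [i|x]; first by case: ifP.
  rewrite big_cons eqxx mul0r add0r gc; apply: eq_big_seq => i ir.
  by rewrite ifN//; apply: contraNneq jr => <-.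
have ajx0 : 0 < a j x0.
  rewrite ltNge; apply/negP => h; move: gx0; rewrite ltNge gle0// => i.
  by rewrite inE => /predU1P[->//|]; exact: x0r.
pose k := (a j x0)^-1.
have k0 : 0 < k by rewrite invr_gt0.
have akE : a j x0 * k = 1 by rewrite mulfV// gt_eqF.
have scE (l : V -> R) s x y : scalar l -> l (x - s *: y) = l x - s * l y.
  by move=> hl; rewrite addrC -scaleNr hl /= mulNr addrC.
(* Replacing [x] by [x - a j x / a j x0 *: x0] puts it on the hyperplane
   [a j = 0], where the induction hypothesis applies. *)
pose proj x := x - (a j x * k) *: x0.
have projs (l : V -> R) : scalar l -> scalar (l \o proj).
  by move=> hl s x y; rewrite /= !scE// !hl /= (ha j) /=; ring.
have [x hx|c c0 gc] := IHr (fun i => a i \o proj) (g \o proj) ur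
    (fun i => projs _ (ha i)) (projs _ hg).
  apply: gle0 => i; rewrite inE => /predU1P[->|]; last exact: hx.
  by rewrite scE// -mulrA (mulrC k) akE mulr1 subrr.
(* The multiplier of [j] is forced by evaluating the identity at [x0]; it is nonnegative because the
   other terms are at most 0 there. *)
exists (fun i => if i == j then k * (g x0 - \sum_(i <- r) c i * a i x0) else c i).
  move=> i; case: ifP => // _; apply: mulr_ge0; [exact: ltW|rewrite subr_ge0].
  apply: le_trans (ltW gx0); rewrite big_seq sumr_le0// => m mr.
  by rewrite mulr_ge0_le0 ?c0// x0r.
move=> x; rewrite big_cons eqxx.
under eq_big_seq => i ir.
  rewrite ifN; last by apply: contraNneq jr => <-.
  over.
have /= := gc x; rewrite scE//.
under eq_bigr do rewrite scE// mulrBr mulrCA.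
rewrite sumrB -mulr_sumr => gE.
by rewrite -[LHS](subrK (a j x * k * g x0)) gE; ring.
Qed.

Lemma farkas (V : lmodType R) (I : finType) (a : I -> V -> R)
    (g : V -> R) : (forall i, scalar (a i)) -> scalar g ->
    (forall x, (forall i, a i x <= 0) -> g x <= 0) ->
  exists2 c : I -> R, forall i, 0 <= c i &
    forall x, g x = \sum_i c i * a i x.
Proof.
move=> ha hg h.
have [|c c0 gc] := farkas_seq (enum_uniq I) ha hg.
  by move=> x hx; apply: h => i; apply: hx; rewrite mem_enum.
by exists c => // x; rewrite gc big_enum.
Qed.

End farkas.

(** * Attainment for quadratic functions on polyhedra *)

Section affine_quadratic.
Context {R : realFieldType}.
Implicit Types V W : lmodType R.

Definition affine V (a : V -> R) : Prop :=
  exists2 l : V -> R, scalar l & exists c, forall x, a x = l x + c.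

Definition affine_map V W (s : V -> W) : Prop :=
  exists2 l : V -> W, linear l & exists c, forall x, s x = l x + c.

(** An inductive form of polynomials of degree at most two that makes sense over any module;
    stability under affine substitution and expansions along lines become short inductions. *)
Inductive quad V : (V -> R) -> Prop :=
| quadM (a b : V -> R) : affine a -> affine b -> quad (fun x => a x * b x)
| quadD (p q : V -> R) : quad p -> quad q -> quad (fun x => p x + q x).

Lemma affine_scalar V (l : V -> R) : scalar l -> affine l.
Proof. by move=> hl; exists l => //; exists 0 => x; rewrite addr0. Qed.

Lemma affine_cst V (c : R) : affine (fun _ : V => c).
Proof.
by exists (fun=> 0) => [s x y /=|]; [ring|exists c => x; rewrite add0r].
Qed.

Lemma affineD V (a b : V -> R) :
  affine a -> affine b -> affine (fun x => a x + b x).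
Proof.
move=> [l hl [c ac]] [m hm [d bd]].
exists (fun x => l x + m x) => [s x y|]; first by rewrite /= hl hm /=; ring.
by exists (c + d) => x; rewrite ac bd; ring.
Qed.

Lemma affineZ V (a : V -> R) k : affine a -> affine (fun x => k * a x).
Proof.
move=> [l hl [c ac]].
exists (fun x => k * l x) => [s x y|]; first by rewrite /= hl /=; ring.
by exists (k * c) => x; rewrite ac; ring.
Qed.

Lemma affine_comp V W (a : W -> R) (s : V -> W) :
  affine a -> affine_map s -> affine (a \o s).
Proof.
move=> [l hl [c ac]] [m hm [d sd]].
exists (l \o m) => [k x y|]; first by rewrite /= hm hl.
have [l' el] := scalar_bundle hl.
by exists (l d + c) => x; rewrite /= ac sd el linearD addrA.
Qed.

Lemma quad_comp V W (q : W -> R) (s : V -> W) :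
  quad q -> affine_map s -> quad (q \o s).
Proof.
move=> hq hs; elim: hq => [a b ha hb|p r _ hp _ hr].
  exact: quadM (affine_comp ha hs) (affine_comp hb hs).
exact: quadD hp hr.
Qed.

Lemma quad_affine V (a : V -> R) : affine a -> quad a.
Proof.
move=> ha; have := quadM ha (affine_cst V 1).
by congr quad; apply/funext => x; rewrite mulr1.
Qed.

Lemma quad_sum V (I : Type) (r : seq I) (q : I -> V -> R) :
  (forall i, quad (q i)) -> quad (fun x => \sum_(i <- r) q i x).
Proof.
move=> hq; elim: r => [|i r IHr].
  under eq_fun do rewrite big_nil.
  exact/quad_affine/affine_cst.
under eq_fun do rewrite big_cons.
exact: quadD.
Qed.

Lemma affine_line V (a : V -> R) : affine a ->
  exists2 l : V -> R, scalar l & forall x s e, a (x + s *: e) = a x + s * l e.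
Proof.
move=> [l hl [c ac]]; exists l => // x s e.
by rewrite !ac (addrC x) hl /=; ring.
Qed.

(** The direction is fixed here and the first-order coefficient is affine in the base point, as
    elimination of a coordinate requires. In [quad_gradient] the base point is fixed and this
    coefficient is linear in the direction. *)
Lemma quad_direction V (q : V -> R) (e : V) : quad q ->
  exists2 d : V -> R, affine d &
    exists k, forall x s, q (x + s *: e) = q x + s * d x + s ^+ 2 * k.
Proof.
elim=> [a b ha hb|p r _ [d hd [k pE]] _ [d' hd' [k' rE]]]; last first.
  exists (fun x => d x + d' x); first exact: affineD.
  by exists (k + k') => x s; rewrite pE rE; ring.
have [l _ al] := affine_line ha; have [m _ bm] := affine_line hb.
exists (fun x => m e * a x + l e * b x); first by apply: affineD; exact: affineZ.
by exists (l e * m e) => x s; rewrite al bm; ring.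
Qed.

Lemma quad_gradient V (q : V -> R) (x : V) : quad q ->
  exists2 l : V -> R, scalar l & exists k : V -> R,
    forall s e, q (x + s *: e) = q x + s * l e + s ^+ 2 * k e.
Proof.
elim=> [a b ha hb|p r _ [l hl [k pE]] _ [l' hl' [k' rE]]]; last first.
  exists (fun e => l e + l' e) => [s y z|]; first by rewrite /= hl hl' /=; ring.
  by exists (fun e => k e + k' e) => s e; rewrite pE rE; ring.
have [l hl al] := affine_line ha; have [m hm bm] := affine_line hb.
exists (fun e => l e * b x + m e * a x) => [s y z|].
  by rewrite /= hl hm /=; ring.
by exists (fun e => l e * m e) => s e; rewrite al bm; ring.
Qed.

End affine_quadratic.

(** * The Frank-Wolfe theorem by elimination of coordinates *)

Section frank_wolfe.
Context {R : realFieldType}.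

Lemma finite_union_min (X : Type) (K : finType) (C : K -> X -> Prop)
    (q : K -> X -> R) :
    (exists k x, C k x) ->
    (forall k x, C k x -> exists2 y, C k y & forall z, C k z -> q k y <= q k z) ->
  exists k x, C k x /\ forall k' y, C k' y -> q k x <= q k' y.
Proof.
move=> [k0 [x0 Ck0]] minC.
suff main (r : seq K) : (exists2 k, k \in r & exists x, C k x) ->
    exists2 k, k \in r &
      exists2 x, C k x & forall k' y, k' \in r -> C k' y -> q k x <= q k' y.
  have [|k _ [x Ckx xmin]] := main (enum K).
    by exists k0; [rewrite mem_enum|exists x0].
  by exists k, x; split => // k' y; apply: xmin; rewrite mem_enum.
elim: r => [[]//|j r IHr] ex.
have [[k kr [x Ckx]]|nr] := pselect (exists2 k, k \in r & exists x, C k x).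
  have {IHr ex} [{}k {}kr [{}x {}Ckx xmin]] :=
    IHr (ex_intro2 _ _ k kr (ex_intro _ x Ckx)).
  have [[y Cjy]|nj] := pselect (exists y, C j y); last first.
    exists k; rewrite ?inE ?kr ?orbT//; exists x => // k' y.
    rewrite inE => /predU1P[-> Cjy|]; last exact: xmin.
    by exfalso; apply: nj; exists y.
  have [{}y {}Cjy ymin] := minC _ _ Cjy.
  have [qxy|qyx] := leP (q k x) (q j y).
    exists k; rewrite ?inE ?kr ?orbT//; exists x => // k' z.
    rewrite inE => /predU1P[-> Cjz|]; last exact: xmin.
    exact: le_trans qxy (ymin _ Cjz).
  exists j; rewrite ?inE ?eqxx//; exists y => // k' z.
  rewrite inE => /predU1P[-> Cjz|kr' Ckz]; first exact: ymin.
  exact: le_trans (ltW qyx) (xmin _ _ kr' Ckz).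
case: ex => k; rewrite inE => /predU1P[-> [x Cjx]|kr ex]; last first.
  by exfalso; apply: nr; exists k.
have [y Cjy ymin] := minC _ _ Cjx.
exists j; rewrite ?inE ?eqxx//; exists y => // k' z.
rewrite inE => /predU1P[-> Cjz|kr Ckz]; first exact: ymin.
by exfalso; apply: nr; exists k' => //; exists z.
Qed.

(** The ratio test of linear programming: [h j] is the fraction of the way from [s0] to [s1] at
    which constraint [j] becomes tight, so the violated constraint with least [h] is the first
    obstacle. *)
Lemma interval_exit (I : finType) (u c : I -> R) (s0 s1 : R) :
    (forall i, u i + s0 * c i <= 0) ->
  (forall i, u i + s1 * c i <= 0) \/
  exists2 i, c i != 0 & exists2 h : R, 0 <= h <= 1 &
    - u i / c i = s0 + h * (s1 - s0) /\
    forall j, u j + (- u i / c i) * c j <= 0.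
Proof.
move=> s0C.
have [s1C|/existsNP[i0 /negP]] := pselect (forall i, u i + s1 * c i <= 0).
  by left.
rewrite -ltNge => i0v; right.
pose h i := - (u i + s0 * c i) / ((s1 - s0) * c i).
case: (@arg_minP _ _ _ i0 (fun i => 0 < u i + s1 * c i) h i0v) => i iv imin.
have den0 j : 0 < u j + s1 * c j -> 0 < (s1 - s0) * c j.
  by move=> jv; have := s0C j; rewrite mulrBl; lra.
have hE j : 0 < u j + s1 * c j -> h j * ((s1 - s0) * c j) = - (u j + s0 * c j).
  by move=> jv; rewrite divfK// gt_eqF// den0.
have ci0 : c i != 0.
  by have := den0 _ iv; apply: contraTneq => ->; rewrite mulr0 ltxx.
have h0 : 0 <= h i by rewrite divr_ge0 ?oppr_ge0// ltW// den0.
have h1 : h i <= 1.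
  by rewrite ler_pdivrMr ?den0// mul1r mulrBl; have := s0C i; lra.
have sE : - u i / c i = s0 + h i * (s1 - s0).
  apply: (mulIf ci0); rewrite divfK// mulrDl -mulrA (hE _ iv); ring.
exists i => //; exists (h i); first by rewrite h0.
split => // j; rewrite sE.
have [jv|jn] := ltP 0 (u j + s1 * c j).
  have := imin _ jv; rewrite -(ler_pM2r (den0 _ jv)) (hE _ jv).
  by move=> hle; rewrite mulrDl addrA -mulrA addrC -lerBrDr sub0r.
rewrite (_ : _ + _ = (1 - h i) * (u j + s0 * c j) + h i * (u j + s1 * c j)).
  by rewrite -[leRHS]addr0 lerD// mulr_ge0_le0 ?subr_ge0.
by ring.
Qed.

Lemma interval_candidates (I : finType) (u c : I -> R) (r d k M s0 : R) :
    (forall i, u i + s0 * c i <= 0) ->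
    (forall s, (forall i, u i + s * c i <= 0) -> M <= r + s * d + s ^+ 2 * k) ->
  exists2 s, (s = 0 \/ s = - d / (k *+ 2) \/ exists i, s = - u i / c i) &
    (forall i, u i + s * c i <= 0) /\
    r + s * d + s ^+ 2 * k <= r + s0 * d + s0 ^+ 2 * k.
Proof.
move=> s0C bnd.
(* Walk from [s0] to a target [s1] along which the quadratic never exceeds its value at [s0]. The
   target is the vertex, or 0 if the quadratic is constant, or a point where the value is below [M];
   the latter is infeasible, so the walk stops at an end [- u i / c i]. *)
suff [s1 cand1 dec] : exists2 s1,
    (forall i, u i + s1 * c i <= 0) -> (s1 = 0 \/ s1 = - d / (k *+ 2)) &
    forall h : R, 0 <= h <= 1 -> let s := s0 + h * (s1 - s0) in
    r + s * d + s ^+ 2 * k <= r + s0 * d + s0 ^+ 2 * k.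
  have [s1C|[i ci0 [h h01 [sE sC]]]] := interval_exit s1 s0C.
    exists s1; first by case: (cand1 s1C); auto.
    split => //; have := dec 1; rewrite /= mul1r subrKC; apply.
    by rewrite ler01 lexx.
  exists (- u i / c i); first by right; right; exists i.
  by split => //; rewrite sE; exact: dec.
have [k0|] := ltP 0 k.
  exists (- d / (k *+ 2)); first by right.
  move=> h /andP[h0 h1] /=.
  have kE : - d / (k *+ 2) * (k *+ 2) = - d.
    by apply: divfK; rewrite gt_eqF// pmulrn_lgt0.
  move: (- d / (k *+ 2)) kE => v kE.
  rewrite [leLHS](_ : _ = r + s0 * d + s0 ^+ 2 * k - k * (v - s0) ^+ 2 * (h * (2 - h))).
    rewrite gerBl; apply: mulr_ge0; apply: mulr_ge0; rewrite ?sqr_ge0//; lra.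
  by have -> : d = - (v * (k *+ 2)) by [rewrite kE opprK]; ring.
rewrite le_eqVlt => /predU1P[k0|k0].
  subst k; have [d0|d0] := eqVneq d 0.
    exists 0; first by left.
    by move=> h _ /=; rewrite d0 !mulr0.
  (* The affine function takes the value [M - 1] at this target. *)
  exists (s0 - (r + s0 * d - M + 1) / d) => [s1C|h /andP[h0 _] /=].
    by have := bnd _ s1C; rewrite mulrBl divfK//; lra.
  have := bnd _ s0C.
  have -> : (s0 + h * (s0 - (r + s0 * d - M + 1) / d - s0)) * d
      = s0 * d - h * (r + s0 * d - M + 1).
    by rewrite -[in RHS](divfK d0 (r + s0 * d - M + 1)); ring.
  rewrite !mulr0 !addr0 => QM; rewrite lerD2l gerBl mulr_ge0//; lra.
pose sg : R := if d + s0 * (k *+ 2) <= 0 then 1 else -1.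
have sgd : sg * (d + s0 * (k *+ 2)) <= 0.
  rewrite /sg; case: (leP (d + s0 * (k *+ 2)) 0) => [|/ltW].
    by rewrite mul1r.
  by rewrite mulN1r oppr_le0.
have sg2 : sg ^+ 2 = 1 by rewrite /sg; case: ifP; rewrite ?sqrrN expr1n.
set Q0 := r + s0 * d + s0 ^+ 2 * k.
have Q0M : M <= Q0 by exact: bnd.
(* A step of length [t] in the direction [sg], where the slope at [s0] is at most 0, brings the
   value down to at most [M + k], which is less than [M]. *)
pose t := 1 + (Q0 - M) / - k.
have tk : t * k = k - (Q0 - M).
  by rewrite /t mulrDl mul1r invrN mulrN mulNr divfK// lt_eqF.
have t1 : 1 <= t by rewrite lerDl divr_ge0// ?oppr_ge0 ?subr_ge0// ltW.
have QE h : let s := s0 + h * (s0 + sg * t - s0) in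
    r + s * d + s ^+ 2 * k =
    Q0 + h * t * (sg * (d + s0 * (k *+ 2))) + h ^+ 2 * t * (t * k).
  rewrite /Q0 /=; transitivity (r + s0 * d + s0 ^+ 2 * k
    + h * t * (sg * (d + s0 * (k *+ 2))) + h ^+ 2 * t * (t * k) * sg ^+ 2).
    by ring.
  by rewrite sg2 mulr1.
exists (s0 + sg * t) => [s1C|h /andP[h0 _]].
  have := bnd _ s1C; have := QE 1; rewrite /= mul1r subrKC => ->.
  rewrite expr1n !mul1r tk.
  have : t * (sg * (d + s0 * (k *+ 2))) <= 0 by rewrite mulr_ge0_le0// ; lra.
  have : t * (k - (Q0 - M)) <= k - (Q0 - M).
    by rewrite -[leRHS]mul1r ler_wnM2r//; lra.
  lra.
rewrite /= QE -addrA gerDl -[leRHS]addr0 lerD// mulr_ge0_le0//.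
- by rewrite mulr_ge0//; lra.
- by rewrite mulr_ge0 ?sqr_ge0//; lra.
- by rewrite tk; lra.
Qed.

Definition attains (V : lmodType R) : Prop :=
  forall (I : finType) (a : I -> V -> R) (q : V -> R) (M : R) (x0 : V),
    (forall i, affine (a i)) -> quad q -> (forall i, a i x0 <= 0) ->
    (forall x, (forall i, a i x <= 0) -> M <= q x) ->
  exists2 x, (forall i, a i x <= 0) &
    forall y, (forall i, a i y <= 0) -> q x <= q y.

(* The coordinate along [e] is eliminated: by [interval_candidates] its best
   value is one of finitely many affine functions of the other coordinates, so
   neither convexity nor compactness is needed. *)
Lemma attains_step (V W : lmodType R) (j : V -> W) (e : W) :
    linear j -> (forall w, exists v s, w = j v + s *: e) ->
  attains V -> attains W.
Proof.
move=> lj decomp attV I a q M x0 ha hq x0C bnd.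
have [c cE] : exists c : I -> R,
    forall i x s, a i (x + s *: e) = a i x + s * c i.
  have /boolp.choice[c cE] : forall i, exists k : R,
      forall x s, a i (x + s *: e) = a i x + s * k.
    by move=> i; have [l _ al] := affine_line (ha i); exists (l e) => x s.
  by exists c.
have [d hd [k qE]] := quad_direction e hq.
(* The three kinds of candidates. They are affine in [v] since the denominators are constants; a
   zero denominator gives the harmless candidate 0. *)
pose tau (o : option (option I)) (v : V) : R :=
  match o with
  | None => 0
  | Some None => - d (j v) / (k *+ 2)
  | Some (Some i) => - a i (j v) / c i
  end.
have jaff : affine_map j by exists j => //; exists 0 => x; rewrite addr0.
have taff o : affine (tau o).
  case: o => [[i|]|] /=; last exact: affine_cst.
    have := affineZ (- (c i)^-1) (affine_comp (ha i) jaff).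
    by congr affine; apply/funext => x /=; rewrite mulrC mulrN mulNr.
  have := affineZ (- (k *+ 2)^-1) (affine_comp hd jaff).
  by congr affine; apply/funext => x /=; rewrite mulrC mulrN mulNr.
pose sig o v := j v + tau o v *: e.
have saff o : affine_map (sig o).
  have [l hl [m tE]] := taff o.
  exists (fun v => j v + l v *: e) => [s x y|].
    by rewrite lj hl /= !scalerDl !scalerDr !scalerA addrACA.
  by exists (m *: e) => x; rewrite /sig tE scalerDl addrA.
pose C o v := forall i, a i (sig o v) <= 0.
have cand w : (forall i, a i w <= 0) ->
    exists o v, C o v /\ q (sig o v) <= q w.
  have [v [s0 ->]] := decomp w => wC.
  have bnd' s : (forall i, a i (j v) + s * c i <= 0) ->
      M <= q (j v) + s * d (j v) + s ^+ 2 * k.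
    by move=> sC; rewrite -qE; apply: bnd => i; rewrite cE.
  have s0C i : a i (j v) + s0 * c i <= 0 by rewrite -cE.
  have [s1 s1E [s1C qle]] := interval_candidates s0C bnd'.
  have {s1E} [k1 s1E] : exists k1, s1 = tau k1 v.
    by case: s1E => [|[|[i]]] ->; [exists None|exists (Some None)|exists (Some (Some i))].
  exists k1, v; split => [i|]; first by rewrite /sig -s1E cE.
  by rewrite /sig -s1E !qE.
have [k1 [v [Cov vmin]]] := @finite_union_min V _ C (fun o v => q (sig o v))
  (let: ex_intro o (ex_intro v (conj Cv _)) := cand _ x0C in
   ex_intro _ o (ex_intro _ v Cv))
  (fun o v Cv => attV I (fun i => a i \o sig o) (q \o sig o) M v
     (fun i => affine_comp (ha i) (saff o)) (quad_comp hq (saff o)) Cv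
     (fun x Cx => bnd _ Cx)).
exists (sig k1 v) => // w wC.
have [k' [v' [Cv' qv']]] := cand _ wC.
exact: le_trans (vmin _ _ Cv') qv'.
Qed.

Lemma attains_rV n : attains 'rV[R]_n.
Proof.
elim: n => [|n IHn].
  move=> I a q M x0 _ _ x0C _; exists x0 => // y _.
  by rewrite (_ : y = x0)//; apply/rowP => -[].
apply: (@attains_step 'rV[R]_n 'rV[R]_(1 + n) (row_mx 0) (row_mx 1%:M 0) _ _ IHn).
  by move=> s x y; rewrite scale_row_mx add_row_mx scaler0 addr0.
move=> w; exists (rsubmx w), (w 0 0).
rewrite scale_row_mx add_row_mx scaler0 addr0 add0r -[LHS](@hsubmxK _ 1 1 n).
congr row_mx; apply/rowP => i; rewrite !mxE ord1 mulr1.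
by congr (w _ _); apply/val_inj.
Qed.

Lemma attains_vect (V : vectType R) : attains V.
Proof.
(* Transfer through coordinates: nothing is eliminated, the extra direction is the zero vector. *)
apply: (@attains_step _ V r2v 0 _ _ (@attains_rV _)); first exact: linearP.
by move=> w; exists (v2r w), 0; rewrite scaler0 addr0 v2rK.
Qed.

End frank_wolfe.

(** * Convex piecewise quadratic functions *)

Section small.
Context {R : realFieldType}.
Implicit Types P Q : R -> Prop.

(** [P] holds eventually as [s] decreases to 0. *)
Definition small P : Prop := exists2 e, 0 < e & forall s, 0 < s <= e -> P s.

Lemma smallW P Q : (forall s, 0 < s -> P s -> Q s) -> small P -> small Q.
Proof.
move=> PQ [e e0 eP]; exists e => // s /[dup] /andP[s0 _] se.
exact: PQ s0 (eP _ se).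
Qed.

Lemma smallI P Q : small P -> small Q -> small (fun s => P s /\ Q s).
Proof.
move=> [e e0 eP] [d d0 dQ]; exists (Num.min e d); first by rewrite lt_min e0.
by move=> s /andP[s0]; rewrite le_min => /andP[se sd]; split;
  [apply: eP|apply: dQ]; rewrite s0.
Qed.

Lemma small_forall (I : finType) (P : I -> R -> Prop) :
  (forall i, small (P i)) -> small (fun s => forall i, P i s).
Proof.
move=> sP; have [e e0 eP] : small (fun s => forall i, i \in enum I -> P i s).
  elim: (enum I) => [|j r IHr]; first by exists 1.
  apply: smallW (smallI (sP j) IHr) => s _ [Pj Pr] i.
  by rewrite inE => /predU1P[->|/Pr].
by exists e => // s /eP + i; apply; rewrite mem_enum.
Qed.

Lemma small_ex P : small P -> exists2 s, 0 < s & P s.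
Proof. by move=> [e e0 eP]; exists e => //; apply: eP; rewrite e0 lexx. Qed.

Lemma small_scale P (k : R) : 0 < k -> small P -> small (fun s => P (k * s)).
Proof.
move=> k0 [e e0 eP]; exists (e / k); first by rewrite divr_gt0.
move=> s /andP[s0 se]; apply: eP.
by rewrite mulr_gt0//= mulrC -ler_pdivlMr.
Qed.

Lemma small_affine_lt0 (a b : R) : a < 0 -> small (fun s => a + s * b < 0).
Proof.
move=> a0; have b1 : 0 < `|b| + 1 by rewrite ltr_wpDl.
exists (- a / (`|b| + 1)); first by rewrite divr_gt0// oppr_gt0.
move=> s /andP[s0]; rewrite ler_pdivlMr// => sb.
have : s * b <= s * `|b| by rewrite ler_pM2l// ler_norm.
by move: sb; rewrite mulrDr mulr1; lra.
Qed.

Lemma small_affine_le (x r y : R) : small (fun s => x + s * r <= y) -> x <= y.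
Proof.
move=> sm; rewrite leNgt; apply/negP => yx.
have [|s _ []] := small_ex (smallI sm (@small_affine_lt0 (y - x) (- r) _)).
  by rewrite subr_lt0.
by rewrite mulrN; lra.
Qed.

End small.

Section plq.
Context {R : realType}.
Implicit Types V W : lmodType R.
Local Open Scope ereal_scope.

(* The constraints of all the polyhedral pieces are indexed by the same type
   [I]; short lists can be padded with the constraint [0 <= 0]. *)
Definition plq V (h : V -> \bar R) : Prop :=
  exists (K I : finType) (a : K -> I -> V -> R) (q : K -> V -> R),
    [/\ forall k i, affine (a k i),
        forall k, quad (q k),
        forall x, h x < +oo -> exists k, forall i, (a k i x <= 0)%R &
        forall k x, (forall i, (a k i x <= 0)%R) -> h x = (q k x)%:E].

(** Testing against real upper bounds keeps products with infinite values out of the inequality. *)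
Definition convexe V (h : V -> \bar R) : Prop :=
  forall x y (s a b : R), (0 <= s <= 1)%R -> h x <= a%:E -> h y <= b%:E ->
    h (s *: x + (1 - s) *: y)%R <= (s * a + (1 - s) * b)%:E.

(** The value -oo is excluded as well: being below +oo, it would place the point in a piece, where
    [h] is real. *)
Lemma plq_fin V (h : V -> \bar R) x : plq h -> h x < +oo -> h x \is a fin_num.
Proof.
by move=> [K [I [a [q [_ _ hdom hE]]]]] /hdom[k xC]; rewrite (hE _ _ xC).
Qed.

Lemma plq_comp V W (h : W -> \bar R) (s : V -> W) :
  plq h -> affine_map s -> plq (h \o s).
Proof.
move=> [K [I [a [q [ha hq hdom hE]]]]] hs.
exists K, I, (fun k i => a k i \o s), (fun k => q k \o s); split => //.
- by move=> k i; exact: affine_comp.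
- by move=> k; exact: quad_comp.
- by move=> x /hdom.
- by move=> k x /hE.
Qed.

Lemma convexe_comp V W (h : W -> \bar R) (s : V -> W) :
  convexe h -> affine_map s -> convexe (h \o s).
Proof.
move=> hh [l hl [c sE]] x y t a b t01 hx hy /=.
pose l' : {linear V -> W} := HB.pack l (GRing.isLinear.Build _ _ _ _ l hl).
have el : l = l' by [].
have -> : (s (t *: x + (1 - t) *: y) = t *: s x + (1 - t) *: s y)%R.
  rewrite !sE el linearD !linearZ !scalerDr addrACA -scalerDl.
  by rewrite subrKC scale1r.
exact: hh.
Qed.

Lemma plq0 V : plq (fun _ : V => 0).
Proof.
exists unit, void, (fun _ => of_void _), (fun _ _ => 0%R); split => //.
  by move=> _; apply: quad_affine; exact: affine_cst.
Qed.

Lemma plqD V (g h : V -> \bar R) : plq g -> plq h -> plq (fun x => g x + h x).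
Proof.
move=> pg ph.
have [K [I [a [q [ha hq hdom hE]]]]] := pg.
have [L [J [b [r [hb hr rdom rE]]]]] := ph.
exists (K * L)%type, (I + J)%type,
  (fun k i => match i with inl i => a k.1 i | inr j => b k.2 j end),
  (fun k x => q k.1 x + r k.2 x)%R; split.
- by move=> k [i|j].
- by move=> k; exact: quadD.
- move=> x ghx.
  have [gx hx] : g x < +oo /\ h x < +oo.
    split; rewrite ltNge leye_eq; apply: contraTN ghx => /eqP ghx.
      rewrite ghx -leNgt addye ?leey//; apply/eqP => hN.
      by have := plq_fin ph (_ : h x < +oo); rewrite hN => /(_ isT).
    rewrite ghx -leNgt addey ?leey//; apply/eqP => hN.
    by have := plq_fin pg (_ : g x < +oo); rewrite hN => /(_ isT).
  have [k kx] := hdom _ gx; have [l lx] := rdom _ hx.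
  by exists (k, l) => -[i|j] /=.
- move=> [k l] x kl; rewrite (hE k x) ?(rE l x) ?EFinD//.
    by move=> j; exact: (kl (inr j)).
  by move=> i; exact: (kl (inl i)).
Qed.

Lemma convexeD V (g h : V -> \bar R) :
  (forall x, -oo < g x) -> (forall x, -oo < h x) -> convexe g -> convexe h ->
  convexe (fun x => g x + h x).
Proof.
move=> g0 h0 cg ch x y s a b s01 hx hy.
have fin z c : g z + h z <= c%:E -> exists a1 a2 : R,
    [/\ g z = a1%:E, h z = a2%:E & (a1 + a2 <= c)%R].
  have := g0 z; have := h0 z.
  case: (g z) (h z) => [a1| |] [a2| |]//= _ _; rewrite ?lee_fin => ac.
  by exists a1, a2.
have [a1 [a2 [gx hx' a12]]] := fin _ _ hx.
have [b1 [b2 [gy hy' b12]]] := fin _ _ hy.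
apply: (le_trans (leeD (cg x y s a1 b1 s01 _ _) (ch x y s a2 b2 s01 _ _))).
- by rewrite gx.
- by rewrite gy.
- by rewrite hx'.
- by rewrite hy'.
move: s01 => /andP[s0 s1]; rewrite -EFinD lee_fin.
have := ler_wpM2l s0 a12.
have : ((1 - s) * (b1 + b2) <= (1 - s) * b)%R by rewrite ler_wpM2l// subr_ge0.
by lra.
Qed.

Lemma plq_sum V (J : Type) (r : seq J) (h : J -> V -> \bar R) :
  (forall j, plq (h j)) -> plq (fun x => \sum_(j <- r) h j x).
Proof.
move=> hh; elim: r => [|j r IHr].
  by under eq_fun do rewrite big_nil; exact: plq0.
by under eq_fun do rewrite big_cons; exact: plqD.
Qed.

Lemma convexe_sum V (J : Type) (r : seq J) (h : J -> V -> \bar R) :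
  (forall j x, -oo < h j x) -> (forall j, convexe (h j)) ->
  convexe (fun x => \sum_(j <- r) h j x).
Proof.
move=> h0 hh; elim: r => [|j r IHr].
  under eq_fun do rewrite big_nil.
  move=> x y s a b /andP[s0 s1]; rewrite !lee_fin => a0 b0.
  by rewrite addr_ge0// mulr_ge0// subr_ge0.
under eq_fun do rewrite big_cons.
apply: convexeD => // x; elim: r {IHr} => [|i r IHr]; rewrite ?big_nil ?big_cons//.
have := h0 i x; case: (h i x) => [u| |]//; last by rewrite addye// gt_eqF.
by case: (\sum_(_ <- _) _) IHr => //= u' _ _; rewrite -EFinD ltNyr.
Qed.

Lemma plq_min (V : vectType R) (h : V -> \bar R) (M : R) (x0 : V) :
  plq h -> h x0 < +oo -> (forall x, M%:E <= h x) ->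
  exists x, forall y, h x <= h y.
Proof.
move=> [K [I [a [q [ha hq hdom hE]]]]] hx0 hM.
have [||k [x [xC xmin]]] := @finite_union_min _ V K
    (fun k x => forall i, (a k i x <= 0)%R) q.
- by have [k kx0] := hdom _ hx0; exists k, x0.
- move=> k x xC; apply: (attains_vect (ha k) (hq k) xC) => y yC.
  by rewrite -lee_fin -(hE _ _ yC).
exists x => y; rewrite (hE _ _ xC).
have [hy|] := ltP (h y) +oo; last by rewrite leye_eq => /eqP ->; rewrite leey.
by have [k' yC] := hdom _ hy; rewrite (hE _ _ yC) lee_fin; exact: xmin yC.
Qed.

End plq.

(** * Subgradients that vanish on a subspace *)

Section subgradient.
Context {R : realType}.

(* The directional derivative of [h] at [v] along [d] is at most [r]. *)
Definition dirle (V : lmodType R) (h : V -> \bar R) (v d : V) (r : R) : Prop :=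
  exists2 c : R, h v = c%:E &
  forall eta : R, 0 < eta -> small (fun s => (h (v + s *: d)%R <= (c + s * (r + eta))%:E)%E).

Lemma dirle0 (V : lmodType R) (h : V -> \bar R) (v : V) c :
  h v = c%:E -> dirle h v 0 0.
Proof.
move=> hv; exists c => // e e0; exists 1 => // s /andP[s0 _].
by rewrite scaler0 addr0 hv lee_fin add0r lerDl mulr_ge0// ltW.
Qed.

(** The point [v + s *: (d + d')] is the midpoint of [v + (2 * s) *: d] and [v + (2 * s) *: d'];
    hence the rescaling of [s] by 2. *)
Lemma dirleD (V : lmodType R) (h : V -> \bar R) (v d d' : V) (r r' : R) :
  convexe h -> dirle h v d r -> dirle h v d' r' -> dirle h v (d + d') (r + r').
Proof.
move=> ch [c hv dr] [c' hv' dr']; exists c => // e e0.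
have cc' : c' = c by move: hv'; rewrite hv => -[].
have e20 : 0 < e / 2 by rewrite divr_gt0.
have := smallI (small_scale (ltr0Sn R 1) (dr _ e20))
  (small_scale (ltr0Sn R 1) (dr' _ e20)).
apply: smallW => s s0 [h1 h2].
have half : 0 <= (2^-1 : R) <= 1 by lra.
have := ch _ _ _ _ _ half h1 h2; rewrite cc'.
rewrite (_ : 1 - 2^-1 = 2^-1 :> R); last by lra.
have -> : 2^-1 *: (v + (2 * s) *: d) + 2^-1 *: (v + (2 * s) *: d')
    = v + s *: (d + d').
  rewrite !scalerDr !scalerA mulrA mulVf// mul1r addrACA -scalerDl.
  by rewrite (_ : 2^-1 + 2^-1 = 1 :> R) ?scale1r//; lra.
by move=> /le_trans; apply; rewrite lee_fin; lra.
Qed.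

Lemma dirle_sum (V : lmodType R) (h : V -> \bar R) (v : V) (K : Type)
    (r : seq K) (P : pred K) (d : K -> V) (g : K -> R) c :
    convexe h -> h v = c%:E -> (forall k, P k -> dirle h v (d k) (g k)) ->
  dirle h v (\sum_(k <- r | P k) d k) (\sum_(k <- r | P k) g k).
Proof.
move=> ch hv hd; elim/big_rec2: _ => [|k x y Pk]; first exact: dirle0 hv.
by move=> /(dirleD ch (hd k Pk)).
Qed.

Lemma dirle_min (V : lmodType R) (h : V -> \bar R) (v d : V) (r : R) :
  (forall s, h v <= h (v + s *: d)%R)%E -> dirle h v d r -> 0 <= r.
Proof.
move=> vmin [c hv dr]; rewrite leNgt; apply/negP => r0.
have [|s s0] := small_ex (dr (- r / 2) _); first by rewrite divr_gt0// oppr_gt0.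
move=> /(le_trans (vmin s)); rewrite hv lee_fin lerDl.
by rewrite pmulr_rge0//; lra.
Qed.

Lemma subgradient_exists (V : vectType R) (X : lmodType R) (h : V -> \bar R)
    (L : X -> V) (v : V) :
    linear L -> plq h -> convexe h -> (h v < +oo)%E ->
    (forall x, h v <= h (v + L x)%R)%E ->
  exists p : V -> R, [/\ scalar p, forall x, p (L x) = 0 &
    forall w, (h v + (p (w - v)%R)%:E <= h w)%E].
Proof.
move=> hL ph ch hv vmin.
pose L' : {linear X -> V} := HB.pack L (GRing.isLinear.Build _ _ _ _ L hL).
have LZ s x : L (s *: x) = s *: L x by exact: (linearZZ L').
have L0 : L 0 = 0 by exact: (linear0 L').
have [c hvE] : exists c, h v = c%:E.
  by exists (fine (h v)); rewrite fineK// plq_fin.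
have [K [I [a [q [ha hq hdom hE]]]]] := ph.
have /boolp.choice[l] : forall ki : K * I, exists l : V -> R, scalar l /\
    forall s e, a ki.1 ki.2 (v + s *: e) = a ki.1 ki.2 v + s * l e.
  by move=> ki; have [l hl al] := affine_line (ha ki.1 ki.2); exists l; split.
move=> /all_and2[hl al].
have /boolp.choice[g] : forall k, exists g : V -> R, scalar g /\
    exists r : V -> R, forall s e, q k (v + s *: e) = q k v + s * g e + s ^+ 2 * r e.
  by move=> k; have [g hg qE] := quad_gradient v (hq k); exists g.
move=> /all_and2[hg /boolp.choice[r qE]].
pose act k := [forall i, a k i v <= 0].
pose tang k d := forall i, a k i v = 0 -> l (k, i) d <= 0.
have qv k : act k -> q k v = c.
  by move=> /forallP ka; move: (hE k v ka); rewrite hvE => -[].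
have tangin k d : act k -> tang k d ->
    small (fun s => h (v + s *: d) = (c + s * g k d + s ^+ 2 * r k d)%:E).
  move=> ka kd; have ka' := forallP ka.
  have : small (fun s => forall i, a k i (v + s *: d) <= 0).
    apply: small_forall => i; have := ka' i; rewrite le_eqVlt => /predU1P[ai0|ai0].
      exists 1 => // s /andP[s0 _]; rewrite (al (k, i)) ai0 add0r.
      by rewrite pmulr_rle0// kd.
    have := small_affine_lt0 (l (k, i) d) ai0; apply: smallW => s s0 /ltW.
    by rewrite (al (k, i)).
  by apply: smallW => s s0 /hE ->; rewrite qE qv.
have tangle k d : act k -> tang k d -> dirle h v d (g k d).
  move=> ka kd; exists c => // e e0.
  have := smallI (tangin _ _ ka kd) (small_affine_lt0 (r k d) (_ : - e < 0)).
  rewrite oppr_lt0 => /(_ e0); apply: smallW => s s0 [-> er].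
  rewrite lee_fin mulrDr addrA lerD2l expr2 -mulrA ler_pM2l//; lra.
(* The system [p \o L = 0], [p <= g k] on the tangent cone of each active
   piece [k] has a solution: by Farkas' lemma the only obstruction would be
   tangent directions [d k] with [\sum_k d k] in the image of [L] and
   [\sum_k g k (d k) < 0], i.e. a descent direction of [h] at [v]. *)
pose W : lmodType R := ({ffun K -> V} * X)%type.
pose dif (w : W) : V := \sum_(k | act k) w.1 k - L w.2.
have ldif : linear dif.
  move=> s x y; rewrite /dif /= hL /= scalerBr scaler_sumr opprD addrACA.
  rewrite -big_split /=; congr (_ + _).
  by apply: eq_bigr => k _; rewrite !ffunE.
(* The first block says that each [d k] with [k] active is tangent to its piece; the other two
   express [dif w = 0], coordinate by coordinate, as pairs of opposite inequalities. *)
pose F (j : (K * I) + ('I_(\dim {:V}) + 'I_(\dim {:V}))) (w : W) : R :=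
  match j with
  | inl ki => if act ki.1 && (a ki.1 ki.2 v == 0) then l ki (w.1 ki.1) else 0
  | inr (inl j) => coord (vbasis {:V}) j (dif w)
  | inr (inr j) => - coord (vbasis {:V}) j (dif w)
  end.
pose G (w : W) : R := - \sum_(k | act k) g k (w.1 k).
have hF j : scalar (F j).
  case: j => [ki|[j|j]] s x y /=.
  - by case: ifP => _; [rewrite !ffunE hl|rewrite mulr0 addr0].
  - by rewrite ldif linearP.
  - by rewrite ldif linearP /= opprD mulrN.
have hG : scalar G.
  move=> s x y; rewrite /G /= mulrN mulr_sumr -opprD -big_split; congr (- _).
  by apply: eq_bigr => k _; rewrite !ffunE hg.
have [w Fw|co co0 GE] := farkas hF hG.
  have wtang k : act k -> tang k (w.1 k).
    by move=> ka i ai0; have := Fw (inl (k, i)); rewrite /= ka ai0 eqxx.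
  have dif0 : dif w = 0.
    rewrite (coord_vbasis (memvf (dif w))) big1// => j _.
    rewrite (_ : coord _ _ _ = 0) ?scale0r//; apply/eqP; rewrite eq_le.
    by have /= -> := Fw (inr (inl j)); have /= := Fw (inr (inr j)); rewrite oppr_le0.
  rewrite /G oppr_le0; apply: (@dirle_min _ h v (L w.2)).
    by move=> s; rewrite -LZ.
  have -> : L w.2 = \sum_(k | act k) w.1 k by apply/esym/subr0_eq.
  by apply: (dirle_sum _ ch hvE) => k ka; exact/tangle/wtang.
(* The subgradient is read off from the multipliers of the equation [dif w = 0]. Testing the Farkas
   identity on [(0, x)] gives [p (L x) = 0], and on a family concentrated at [k] gives [p <= g k] on
   the tangent cone of that piece. *)
pose p u := - \sum_j (co (inr (inl j)) - co (inr (inr j))) * coord (vbasis {:V}) j u.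
have hp : scalar p.
  move=> s x y; rewrite /p /= mulrN mulr_sumr -opprD -big_split; congr (- _).
  by apply: eq_bigr => j _; rewrite linearP /=; ring.
have [p' pE] := scalar_bundle hp.
have {}GE w : G w = \sum_ki co (inl ki) * F (inl ki) w - p (dif w).
  rewrite GE big_sumType big_sumType; congr (_ + _).
  rewrite /p opprK /= -big_split; apply: eq_bigr => j _ /=; ring.
have pL x : p (L x) = 0.
  have := GE (0, x); rewrite /G /dif /=.
  rewrite big1 => [|k _]; last first.
    by rewrite ffunE; have [g' ->] := scalar_bundle (hg k); rewrite linear0.
  rewrite big1 => [|ki _]; last first.
    rewrite ffunE; case: ifP => _; rewrite ?mulr0//.
    by have [l' ->] := scalar_bundle (hl ki); rewrite linear0 mulr0.
  rewrite big1 => [|k _]; last by rewrite ffunE.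
  by rewrite pE !sub0r linearN opprK oppr0.
have pg k d : act k -> tang k d -> p d <= g k d.
  move=> ka kd; pose D : {ffun K -> V} := [ffun k' => if k' == k then d else 0].
  have Dsum : \sum_(k' | act k') D k' = d.
    rewrite (bigD1 k)//= ffunE eqxx big1 ?addr0// => k' /andP[_ /negPf kk'].
    by rewrite ffunE kk'.
  have gDsum : \sum_(k' | act k') g k' (D k') = g k d.
    rewrite (bigD1 k)//= ffunE eqxx big1 ?addr0// => k' /andP[_ /negPf kk'].
    by rewrite ffunE kk'; have [g' ->] := scalar_bundle (hg k'); rewrite linear0.
  have := GE (D, 0); rewrite /G /dif /= Dsum gDsum L0 subr0.
  set S := \sum_ki _ => SE; suff : S <= 0 by lra.
  rewrite /S sumr_le0// => -[k' i] _ /=; rewrite mulr_ge0_le0//.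
  case: ifP => //= /andP[_ /eqP ai0]; rewrite ffunE; case: eqP => [kk'|_].
    by subst k'; exact: kd.
  by have [l' ->] := scalar_bundle (hl (k', i)); rewrite linear0.
exists p; split => // w.
have [hw|] := ltP (h w) +oo%E; last by rewrite leye_eq => /eqP ->; rewrite leey.
have [b hwE] : exists b, h w = b%:E.
  by exists (fine (h w)); rewrite fineK// plq_fin.
have seg : small (fun s => (h (v + s *: (w - v))%R <= (c + s * (b - c))%:E)%E).
  exists 1 => // s /andP[s0 s1].
  have := ch w v s b c; rewrite (ltW s0) s1 hwE hvE => /(_ isT (lexx _) (lexx _)).
  have -> : s *: w + (1 - s) *: v = v + s *: (w - v).
    by rewrite scalerBl scale1r scalerBr addrCA.
  by move=> /le_trans; apply; rewrite lee_fin; lra.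
(* Some active piece contains a segment issued from [v] towards [w]: if not,
   the points of that segment near [v] would lie in no piece. *)
have [k [ka kd]] : exists k, act k /\ tang k (w - v).
  apply: contrapT => nk.
  have : small (fun s => forall k, ~ forall i, a k i (v + s *: (w - v)) <= 0).
    apply: small_forall => k.
    have [i [ai ali]] : exists i, 0 <= a k i v /\
        (a k i v = 0 -> 0 < l (k, i) (w - v)).
      apply: contrapT => ni; apply: nk; exists k; split.
        apply/forallP => i; rewrite leNgt; apply/negP => ai; apply: ni.
        by exists i; split; [exact: ltW|move=> ai0; rewrite ai0 ltxx in ai].
      move=> i ai0; rewrite leNgt; apply/negP => li; apply: ni.
      by exists i; rewrite ai0.
    have sm : small (fun s => 0 < a k i (v + s *: (w - v))).
      move: ai; rewrite le_eqVlt => /predU1P[/esym ai0|ai0].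
        exists 1 => // s /andP[s0 _]; rewrite (al (k, i)) ai0 add0r.
        by rewrite mulr_gt0// ali.
      have := small_affine_lt0 (- l (k, i) (w - v)) (_ : - a k i v < 0).
      rewrite oppr_lt0 => /(_ ai0); apply: smallW => s s0.
      by rewrite (al (k, i)) mulrN -opprD oppr_lt0.
    by apply: smallW sm => s _ + /(_ i); rewrite ltNge => /negP.
  move=> /(smallI seg)/small_ex[s s0 [hs]]; have [|k kC] := hdom (v + s *: (w - v)).
    exact: le_lt_trans hs (ltry _).
  by move=> /(_ k).
rewrite hvE hwE -EFinD lee_fin -lerBrDl; apply: le_trans (pg _ _ ka kd) _.
(* Convexity bounds [h] on the segment by its chord, while on piece [k] it equals its expansion;
   divide the comparison by [s] and let [s] tend to 0. *)
apply: (@small_affine_le _ _ (r k (w - v))).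
apply: smallW (smallI seg (tangin _ _ ka kd)) => s s0 [+ hs].
rewrite hs lee_fin -addrA lerD2l expr2 -mulrA -mulrDr ler_pM2l//.
Qed.

End subgradient.

(** * Strict separation of a domain from an affine subspace *)

Section separation.
Context {R : realType}.

(* [r] is the difference between two nearest points of [dom h] and of the
   affine subspace; they exist by the Frank-Wolfe theorem even though
   [dom h] is not compact. *)
Lemma strict_separation (V X : vectType R) (h : V -> \bar R) (L : X -> V)
    (b v0 : V) :
    linear L -> plq h -> convexe h -> (h v0 < +oo)%E ->
    (forall x, h (b + L x) = +oo%E) ->
  exists (p : V -> R) (v : V), [/\ scalar p, forall x, p (L x) = 0,
    (h v < +oo)%E, forall w, (h w < +oo)%E -> p w <= p v & p v < p b].
Proof.
move=> hL ph ch hv0 hLb.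
pose L' : {linear X -> V} := HB.pack L (GRing.isLinear.Build _ _ _ _ L hL).
have LN x : L (- x) = - L x by exact: (linearN L').
have L0 : L 0 = 0 by exact: (linear0 L').
pose ip (u v : V) : R :=
  \sum_j coord (vbasis {:V}) j u * coord (vbasis {:V}) j v.
have lip r : scalar (ip r).
  move=> s x y; rewrite /ip /= mulr_sumr -big_split; apply: eq_bigr => j _ /=.
  by rewrite linearP /=; ring.
have ip_gt0 u : u != 0 -> 0 < ip u u.
  move=> u0; rewrite lt_def sumr_ge0 ?andbT => [|j _]; last by rewrite -expr2 sqr_ge0.
  apply: contra u0; rewrite psumr_eq0 => [/allP u0|j _]; last first.
    by rewrite -expr2 sqr_ge0.
  rewrite (coord_vbasis (memvf u)) big1// => j _.
  by have := u0 j (mem_index_enum _); rewrite mulf_eq0 orbb => /eqP ->; rewrite scale0r.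
have ip_line r e s : ip (r + s *: e) (r + s *: e) =
    ip r r + s * (2 * ip r e) + s ^+ 2 * ip e e.
  rewrite /ip !mulr_sumr -!big_split; apply: eq_bigr => j _ /=.
  by rewrite !linearD !linearZ /=; ring.
pose D (w : X * V) : V := w.2 - L w.1 - b.
have D_aff : affine_map D.
  exists (fun w : X * V => w.2 - L w.1); last by exists (- b).
  by move=> s x y; rewrite /= hL scalerBr opprD addrACA.
have ip_quad : quad (fun u => ip u u).
  by apply: quad_sum => j; apply: quadM; apply: affine_scalar => s x y /=;
    rewrite linearP.
(* The squared distance as an extended function on the product; its pieces are those of [h], all
   with the same quadratic formula, so [plq_min] yields a nearest pair. *)
pose H (w : X * V) : \bar R := if (h w.2 < +oo)%E then (ip (D w) (D w))%:E else +oo%E.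
have pH : plq H.
  have [K [I [a [q [ha hq hdom hE]]]]] := ph.
  exists K, I, (fun k i w => a k i w.2), (fun _ w => ip (D w) (D w)); split.
  - move=> k i; apply: (affine_comp (s := snd) (ha k i)).
    by exists snd => //; exists 0 => w; rewrite addr0.
  - by move=> _; exact: (quad_comp ip_quad).
  - by move=> w; rewrite /H; case: ifP => // /hdom.
  - by move=> k w wC; rewrite /H (hE k)// ltry.
have [||[x v] xvmin] := plq_min (M := 0) (x0 := (0, v0)) pH.
- by rewrite /H hv0 ltry.
- move=> w; rewrite /H; case: ifP => _; rewrite ?leey// lee_fin.
  by rewrite sumr_ge0// => j _; rewrite -expr2 sqr_ge0.
have hv : (h v < +oo)%E.
  rewrite ltNge leye_eq; apply/negP => /eqP hv; have := xvmin (0, v0).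
  by rewrite /H hv hv0.
pose r := D (x, v).
have r0 : r != 0.
  apply: contraTneq hv => /subr0_eq; rewrite /= => vE.
  by rewrite -(hLb x) -vE /= subrK ltxx.
have fin w : (h w < +oo)%E -> exists c, h w = c%:E.
  by move=> hw; exists (fine (h w)); rewrite fineK// plq_fin.
(* The variational inequality at the nearest pair: move from [(x, v)] in the direction [(y, w - v)],
   which stays in the domain by convexity, and differentiate the squared distance. *)
have opt y w : (h w < +oo)%E -> 0 <= ip r (w - v - L y).
  move=> hw; suff : 0 <= 2 * ip r (w - v - L y) by rewrite pmulr_rge0.
  apply: (@small_affine_le _ _ (- ip (w - v - L y) (w - v - L y))).
  exists 1 => // s /andP[s0 s1].
  have hs : (h (v + s *: (w - v))%R < +oo)%E.
    have [cw cwE] := fin _ hw; have [cv cvE] := fin _ hv.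
    have := ch w v s cw cv; rewrite (ltW s0) s1 cwE cvE => /(_ isT (lexx _) (lexx _)).
    have -> : s *: w + (1 - s) *: v = v + s *: (w - v).
      by rewrite scalerBl scale1r scalerBr addrCA.
    by move=> /le_lt_trans; apply; exact: ltry.
  have := xvmin (x + s *: y, v + s *: (w - v)).
  rewrite /H /= hv hs lee_fin.
  have -> : D (x + s *: y, v + s *: (w - v)) = r + s *: (w - v - L y).
    rewrite /r /D /= [x + _]addrC hL [_ + L x]addrC opprD addrACA addrAC [in RHS]scalerBr.
    by rewrite (addrAC v) (addrAC (v - L x)).
  rewrite -/r ip_line -addrA lerDl expr2 -mulrA -mulrDr pmulr_rge0//.
  by lra.
have [r' rE] := scalar_bundle (lip r).
exists (fun w => - ip r w), v; split => //.
- by move=> s y w; rewrite lip /=; ring.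
- move=> y; apply/eqP; rewrite oppr_eq0 eq_le; apply/andP; split.
    by have := opt y v hv; rewrite subrr sub0r rE linearN oppr_ge0.
  by have := opt (- y) v hv; rewrite subrr sub0r LN opprK.
- by move=> w hw; have := opt 0 w hw; rewrite L0 subr0 rE linearB /=; lra.
- have Lx : ip r (L x) = 0.
    apply/eqP; rewrite eq_le; apply/andP; split.
      by have := opt x v hv; rewrite subrr sub0r rE linearN oppr_ge0.
    by have := opt (- x) v hv; rewrite subrr sub0r LN opprK.
  have := ip_gt0 _ r0; rewrite {2}/r /D /= rE !linearB -rE Lx /=; lra.
Qed.

End separation.

(** * Lower bound on log-concave densities *)

Section measurability.
Context {R : realType} {n : nat}.
Let T := n.-tuple (measurableTypeR R).
Definition colt (v : T) : 'cV[R]_n := \col_i tnth v i.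

Lemma scalar_col (l : 'cV[R]_n -> R) : scalar l ->
  exists c : 'cV[R]_n, forall x, l x = dotp x c.
Proof.
move=> /scalar_bundle[{}l ->]; exists (\col_i l (delta_mx i 0)) => x.
rewrite [in LHS](matrix_sum_delta x) linear_sum /dotp mxE; apply: eq_bigr => i _.
by rewrite big_ord1 linearZ !mxE.
Qed.

Lemma measurable_affine (a : 'cV[R]_n -> R) : affine a ->
  measurable_fun setT (a \o colt).
Proof.
move=> [l /scalar_col[c lE] [d aE]].
rewrite (_ : a \o colt = fun v : T => \sum_i tnth v i * c i 0 + d); last first.
  apply/funext => v /=; rewrite aE lE /dotp mxE; congr (_ + _).
  by apply: eq_bigr => i _; rewrite !mxE.
apply: measurable_funD => //; apply: measurable_sum => i.
by apply: measurable_funM => //; exact: measurable_tnth.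
Qed.

Lemma measurable_quad (q : 'cV[R]_n -> R) : quad q ->
  measurable_fun setT (q \o colt).
Proof.
elim=> [a b ha hb|p r _ hp _ hr].
  by apply: measurable_funM; exact: measurable_affine.
exact: measurable_funD hp hr.
Qed.

(** The composite is a finite nest of conditionals: the formula of the first piece that contains the
    point, and [phi +oo] outside all pieces. Hence [phi] is tested on the reals only. *)
Lemma measurable_plq (h : 'cV[R]_n -> \bar R) (phi : \bar R -> \bar R) :
  plq h -> measurable_fun setT (phi \o EFin) ->
  measurable_fun setT (phi \o h \o colt).
Proof.
move=> [K [I [a [q [ha hq hdom hE]]]]] mphi.
pose P k (v : T) := all (fun i => a k i (colt v) <= 0) (enum I).
have PP k v : reflect (forall i, a k i (colt v) <= 0) (P k v).
  apply: (iffP allP) => [aP i|aP i _]; last exact: aP.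
  by apply: aP; rewrite mem_enum.
have mP k : measurable_fun setT (P k).
  rewrite /P; elim: (enum I) => [|i s IHs] /=; first exact: measurable_cst.
  apply: measurable_and => //.
  by apply: measurable_fun_ler => //; exact: measurable_affine.
pose f s (v : T) := foldr (fun k y => if P k v then phi (q k (colt v))%:E else y)
  (phi +oo%E) s.
have mf s : measurable_fun setT (f s).
  rewrite /f; elim: s => [|k s IHs] /=; first exact: measurable_cst.
  apply: measurable_fun_ifT => //.
  exact: (measurableT_comp mphi (measurable_quad (hq k))).
suff -> : phi \o h \o colt = f (enum K) by [].
apply/funext => v /=.
have fE s : (exists2 k, k \in s & P k v) -> f s v = phi (h (colt v)).
  rewrite /f; elim: s => [[]//|k s IHs] [k' + k'P] /=.
  case: ifPn => [/PP/hE ->//|kP].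
  by rewrite inE => /predU1P[k'k|k's]; [rewrite -k'k k'P in kP|apply: IHs; exists k'].
have [hv|] := ltP (h (colt v)) +oo%E.
  have [k kP] := hdom _ hv; rewrite fE//; exists k; first by rewrite mem_enum.
  exact/PP.
rewrite leye_eq => /eqP hv; rewrite hv /f.
elim: (enum K) => //= k s <-; case: ifP => // /PP/hE.
by rewrite hv.
Qed.

End measurability.

(** * Lebesgue measure under the map [v |-> (v + x) / 2] *)

Section scaling.
Context {R : realType}.
Local Open Scope ereal_scope.
Notation T := (measurableTypeR R).

Lemma measurable_half1 (a : R) :
  measurable_fun setT (fun t : T => ((t + a) / 2)%R : T).
Proof. by apply: measurable_funM => //; exact: measurable_funD. Qed.

(** Half the image of Lebesgue measure under [t |-> (t + a) / 2] gives half-open intervals their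
    length, so it is Lebesgue measure by uniqueness. *)
Lemma integral_half1 (f : T -> \bar R) (a : R) :
  measurable_fun setT f -> (forall t, 0 <= f t) ->
  \int[lebesgue_measure]_t f ((t + a) / 2)%R = 2%:E * \int[lebesgue_measure]_t f t.
Proof.
move=> mf f0; pose phi (t : T) : T := ((t + a) / 2)%R.
have mphi : measurable_fun setT phi by exact: measurable_half1.
have [push pushE] : exists push : {measure set T -> \bar R},
    push = pushforward (@lebesgue_measure R) phi :> (set T -> \bar R).
  by unshelve eexists (pushforward (@lebesgue_measure R) phi).
have half0 : (0 <= (2^-1 : R))%R by [].
pose half : {nonneg R}%R := NngNum half0.
pose nu := mscale half push.
have nuE A : measurable A -> lebesgue_measure A = nu A.
  apply: lebesgue_measure_unique => _ [[c d] _ <-] /=.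
  rewrite /nu /mscale pushE /pushforward /=.
  rewrite (_ : phi @^-1` _ = [set` `](2 * c - a)%R, (2 * d - a)%R]]); last first.
    apply/seteqP; split => t /=; rewrite !in_itv /= /phi ltr_pdivlMr// ler_pdivrMr//;
      by move=> /andP[tc td]; apply/andP; split; lra.
  rewrite !lebesgue_measure_itv/= !lte_fin.
  have -> : ((2 * c - a < 2 * d - a) = (c < d))%R by apply/idP/idP; lra.
  case: ifP => _; last by rewrite mule0.
  by rewrite -!EFinB -EFinM; congr _%:E; lra.
rewrite [in RHS](@eq_measure_integral _ _ _ _ nu) => [|A mA _]; last exact: nuE.
rewrite ge0_integral_mscale//= pushE ge0_integral_pushforward//.
by rewrite muleA -EFinM divff// mul1e.
Qed.

Definition halft n (x : 'cV[R]_n) (v : n.-tuple T) : n.-tuple T :=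
  [tuple ((tnth v i + x i 0) / 2)%R | i < n].

Lemma measurable_halft n (x : 'cV[R]_n) : measurable_fun setT (halft x).
Proof.
apply/measurable_fun_tnthP => i.
rewrite (_ : _ \o _ = fun v => ((tnth v i + x i 0) / 2)%R).
  by apply: measurable_funM => //; apply: measurable_funD => //; exact: measurable_tnth.
by apply/funext => v /=; rewrite tnth_mktuple.
Qed.

Lemma integral_lebesgue_tupleS n (f : n.+1.-tuple T -> \bar R) :
  measurable_fun setT f -> (forall v, 0 <= f v) ->
  \int[lebesgue_tuple R n.+1]_v f v =
  \int[lebesgue_measure]_t \int[lebesgue_tuple R n]_v f (tcons (t, v)).
Proof.
move=> mf f0.
rewrite /= /lebesgue_step ge0_integral_pushforward//; last exact: measurable_tcons.
rewrite fubini_tonelli1//; last by move=> p; exact: f0.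
exact: (measurableT_comp mf (@measurable_tcons _ _)).
Qed.

(** By Tonelli, each coordinate contributes one factor 2. *)
Lemma integral_half n (f : n.-tuple T -> \bar R) (x : 'cV[R]_n) :
  measurable_fun setT f -> (forall v, 0 <= f v) ->
  \int[lebesgue_tuple R n]_v f (halft x v) =
  (2 ^+ n)%:E * \int[lebesgue_tuple R n]_v f v.
Proof.
elim: n => [|n IHn] in f x *.
  move=> _ _; rewrite expr0 mul1e; apply: eq_integral => v _.
  by congr f; rewrite [LHS]tuple0 [RHS]tuple0.
move=> mf f0.
pose x' : 'cV[R]_n := \col_i x (lift ord0 i) ord0.
have halfE t v : halft x (tcons (t, v)) = tcons (((t + x ord0 ord0) / 2)%R, halft x' v).
  apply: eq_from_tnth => i; rewrite tnth_mktuple.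
  case: (unliftP ord0 i) => [j|] ->; last by [].
  by rewrite !tnthS tnth_mktuple !mxE.
rewrite integral_lebesgue_tupleS//; last first.
  exact: (measurableT_comp mf (measurable_halft x)).
rewrite integral_lebesgue_tupleS//.
pose g t := \int[lebesgue_tuple R n]_v f (tcons (t, v)).
have mg : measurable_fun setT g.
  apply: (measurable_fun_fubini_tonelli_F (m2 := lebesgue_tuple R n)
    (f \o @tcons R n)) => [|p]; last exact: f0.
  exact: (measurableT_comp mf (@measurable_tcons _ _)).
have g0 t : 0 <= g t by exact: integral_ge0.
transitivity (\int[lebesgue_measure]_t ((2 ^+ n)%:E * g ((t + x ord0 ord0) / 2)%R)).
  apply: eq_integral => t _; under eq_integral do rewrite halfE.
  rewrite (IHn (fun v => f (tcons (((t + x ord0 ord0) / 2)%R, v))))//.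
  apply: (measurableT_comp mf); apply: (measurableT_comp (@measurable_tcons _ _)).
  exact: measurable_fun_pair.
rewrite ge0_integralZl//; last exact: (measurableT_comp mg (measurable_half1 _)).
by rewrite integral_half1// muleA -EFinM -exprSr.
Qed.

End scaling.

Section bounded_below.
Context {R : realType} {n : nat}.
Implicit Types h : 'cV[R]_n -> \bar R.

Lemma affine_mulmx m (A : 'M[R]_(m, n)) i : affine (fun x : 'cV[R]_n => (A *m x) i 0).
Proof.
by apply: affine_scalar => s x y /=; rewrite mulmxDr -scalemxAr !mxE.
Qed.

Lemma dotpE (x y : 'cV[R]_n) : dotp x y = \sum_i x i 0 * y i 0.
Proof. by rewrite /dotp mxE; apply: eq_bigr => i _; rewrite mxE. Qed.

Lemma piecewise_linear_quadratic_plq h : piecewise_linear_quadratic h -> plq h.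
Proof.
move=> [N [C [polyC domE qP]]].
have /boolp.choice[P PE] : forall k, exists P : {m & ('M[R]_(m, n) * 'cV[R]_m)%type},
    C k = [set x | forall i, ((projT2 P).1 *m x) i 0 <= (projT2 P).2 i 0].
  by move=> k; have [m [A [b ->]]] := polyC k; exists (existT _ m (A, b)).
have /boolp.choice[q qE] : forall k, exists q : 'cV[R]_n -> R,
    quad q /\ forall x, C k x -> h x = (q x)%:E.
  move=> k; have [Q [c [d E]]] := qP k.
  exists (fun x => dotp x (Q *m x) + dotp c x + d); split => //.
  apply: quadD; last exact/quad_affine/affine_cst.
  apply: quadD; last exact/quad_affine/affine_mulmx.
  under eq_fun do rewrite dotpE.
  apply: quad_sum => i; apply: quadM; last exact: affine_mulmx.
  by apply: affine_scalar => s x y /=; rewrite !mxE.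
pose I := 'I_(\max_k projT1 (P k)).
pose a k (i : I) (x : 'cV[R]_n) : R :=
  if insub (val i) is Some j then
    ((projT2 (P k)).1 *m x) j 0 - (projT2 (P k)).2 j 0 else 0.
have aC k x : (forall i, a k i x <= 0) <-> C k x.
  rewrite PE /=; split => xC i; last first.
    by rewrite /a; case: insub => [j|//]; rewrite subr_le0.
  have iM : (i < \max_k projT1 (P k))%N.
    exact: leq_trans (ltn_ord i) (leq_bigmax k).
  by have := xC (Ordinal iM); rewrite /a /= valK subr_le0.
exists 'I_N, I, a, q; split.
- move=> k i; rewrite /a; case: insub => [j|]; last exact: affine_cst.
  by apply: affineD; [exact: affine_mulmx|exact: affine_cst].
- by move=> k; have [] := qE k.
- move=> x hx; have : dom h x by [].
  by rewrite domE => -[k _ /aC]; exists k.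
- by move=> k x /aC; apply: (qE k).2.
Qed.

Lemma convex_efun_convexe h : convex_efun h -> convexe h.
Proof.
move=> ch x y s a b s01 hx hy; apply: le_trans (ch _ _ _ s01) _.
have /andP[s0 s1] := s01.
by rewrite [leRHS]EFinD !EFinM leeD// lee_wpmul2l// lee_fin ?subr_ge0.
Qed.

(* Integrating [exp (- h ((v + x) / 2)) >= exp (- h x / 2) exp (- h v / 2)] over
   [v] bounds [exp (- h x / 2)] by a constant. *)
Lemma log_concave_density_bounded_below h :
  log_concave_density h -> piecewise_linear_quadratic h ->
  exists M : R, forall x, (M%:E <= h x)%E.
Proof.
move=> [hNy ch _ int1] /piecewise_linear_quadratic_plq ph.
pose mu := lebesgue_tuple R n.
pose E (y : \bar R) := expeR (- y).
pose G (y : \bar R) := expeR (- ((2^-1)%:E * y)%E)%E.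
have mE : measurable_fun setT (E \o h \o colt).
  apply: measurable_plq => //; apply/measurable_EFinP.
  by apply: measurableT_comp => //; exact: measurable_oppr.
have mG : measurable_fun setT (G \o h \o colt).
  apply: measurable_plq => //; apply/measurable_EFinP.
  apply: measurableT_comp => //; apply: measurableT_comp => //.
have key x v : (G (h x) * G (h (colt v)) <= E (h (colt (halft x v))))%E.
  have half : 0 <= (2^-1 : R) <= 1 by lra.
  have := ch x (colt v) _ half.
  have -> : 2^-1 *: x + (1 - 2^-1) *: colt v = colt (halft x v).
    by apply/colP => i; rewrite !mxE tnth_mktuple; lra.
  rewrite (_ : 1 - 2^-1 = 2^-1 :> R); last by lra.
  have Gy : G +oo%E = 0%E by rewrite /G gt0_muley// lte_fin.
  have := hNy x; have := hNy (colt v).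
  case: (h (colt v)) => [b| |]// _; last by rewrite Gy mule0 expeR_ge0.
  case: (h x) => [c| |]// _; last by rewrite Gy mul0e expeR_ge0.
  move=> hle; rewrite -!EFinM -EFinD in hle; rewrite /G /E -expeRD lee_expeR.
  by rewrite -!EFinM -!EFinN -EFinD -opprD EFinN leeN2.
have intE x : (\int[mu]_v (E \o h \o colt) (halft x v) = (2 ^+ n)%:E)%E.
  rewrite integral_half// => [|v]; last exact: expeR_ge0.
  by rewrite [X in (_ * X)%E]int1 mule1.
have G_gt0 : (0 < \int[mu]_v (G \o h \o colt) v)%E.
  rewrite lt_def integral_ge0 ?andbT => [|v _]; last exact: expeR_ge0.
  apply/negP => /eqP intG0.
  (* If the integral of [exp (- h / 2)] vanished, [h] would be +oo almost everywhere, against total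
     mass 1. *)
  have /(ae_eq_integral_abs mu measurableT mG) G0 :
      (\int[mu]_v `|(G \o h \o colt) v| = 0)%E.
    by rewrite -intG0; apply: eq_integral => v _; rewrite gee0_abs// expeR_ge0.
  have : (\int[mu]_v (E \o h \o colt) v = \int[mu]_v (cst 0 v))%E.
    apply: ae_eq_integral => //.
    apply: filterS G0 => v /= /(_ Logic.I) Gv _.
    move/eqP: Gv; rewrite expeR_eq0 /E.
    by have := hNy (colt v); case: (h (colt v)).
  by rewrite integral0 [LHS]int1 => /eqP; rewrite gt_eqF.
(* This integral may be infinite a priori; a positive real minorant is enough. *)
have [e e0 eG] : exists2 e : R, 0 < e & (e%:E <= \int[mu]_v (G \o h \o colt) v)%E.
  move: G_gt0; case: (\int[mu]_v _)%E => [e| |]// e0; first by exists e.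
  by exists 1 => //; rewrite leey.
have Gle x : (G (h x) * e%:E <= (2 ^+ n)%:E)%E.
  rewrite -(intE x); apply: le_trans (lee_wpmul2l (expeR_ge0 _) eG) _.
  rewrite -ge0_integralZl//; last 2 first.
  - by move=> v _; exact: expeR_ge0.
  - exact: expeR_ge0.
  apply: ge0_le_integral => //.
  - by move=> v _; rewrite mule_ge0// expeR_ge0.
  - exact: measurable_funeM.
  - exact: (measurableT_comp mE (measurable_halft x)).
  - by move=> v _; exact: key.
(* Solve [expR (- r / 2) * e <= 2 ^+ n] for [r]. *)
exists (- 2 * ln (2 ^+ n / e)) => x.
have := Gle x; have := hNy x; rewrite /G; case: (h x) => [r| |]//= _.
  rewrite -EFinM !lee_fin -ler_pdivlMr// => hr.
  have := expR_gt0 (- (2^-1 * r)) => /[dup] r0 /lt_le_trans /(_ hr) B0.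
  by move: hr; rewrite -ler_ln ?posrE// expRK; lra.
by move=> _; rewrite leey.
Qed.

End bounded_below.

(** * Duality between estimation and control *)

Section dotp.
Context {R : realType} {n : nat}.
Implicit Types x y : 'cV[R]_n.

Lemma dotp_scalar y : scalar (dotp^~ y).
Proof.
by move=> s x x'; rewrite !dotpE /= mulr_sumr -big_split; apply: eq_bigr => i _;
  rewrite /= !mxE; ring.
Qed.

Lemma dotpBl x x' y : dotp (x - x') y = dotp x y - dotp x' y.
Proof. by have [l E] := scalar_bundle (dotp_scalar y); move: (linearB l x x'); rewrite -E. Qed.

Lemma dotpNl x y : dotp (- x) y = - dotp x y.
Proof. by have [l E] := scalar_bundle (dotp_scalar y); move: (linearN l x); rewrite -E. Qed.

Lemma dotp0l y : dotp 0 y = 0.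
Proof. by have [l E] := scalar_bundle (dotp_scalar y); move: (linear0 l); rewrite -E. Qed.

Lemma dotpC x y : dotp x y = dotp y x.
Proof. by rewrite !dotpE; apply: eq_bigr => i _; rewrite mulrC. Qed.

Lemma dotpBr x y y' : dotp x (y - y') = dotp x y - dotp x y'.
Proof. by rewrite dotpC dotpBl !(dotpC x). Qed.

Lemma dotpZr (s : R) x y : dotp x (s *: y) = s * dotp x y.
Proof. by rewrite !dotpE mulr_sumr; apply: eq_bigr => i _; rewrite mxE mulrCA. Qed.

Lemma dotp_ge0 x : 0 <= dotp x x.
Proof. by rewrite dotpE sumr_ge0// => i _; rewrite -expr2 sqr_ge0. Qed.

Lemma dotp_eq0 x : dotp x x = 0 -> x = 0.
Proof.
move=> /eqP; rewrite dotpE psumr_eq0 => [/allP x0|i _]; last by rewrite -expr2 sqr_ge0.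
apply/colP => i; have := x0 i (mem_index_enum _).
by rewrite mulf_eq0 orbb mxE => /eqP.
Qed.

End dotp.

Lemma dotp_mulmxl (R : realType) (m n : nat) (A : 'M[R]_(m, n)) x y :
  dotp (A *m x) y = dotp x (A^T *m y).
Proof. by rewrite /dotp trmx_mul mulmxA. Qed.

Lemma log_concave_density_proper (R : realType) (n : nat) (h : 'cV[R]_n -> \bar R) :
  log_concave_density h -> exists x, (h x < +oo)%E.
Proof.
move=> [_ _ _ int1]; apply: contrapT => hy; move: int1.
rewrite (eq_integral (cst 0%E)) => [|v _ /=].
  by rewrite integral0 => /esym/eqP; rewrite gt_eqF.
set x := \col_i _; suff -> : h x = +oo%E by [].
by apply/eqP; rewrite -leye_eq leNgt; apply/negP => hx; apply: hy; exists x.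
Qed.

Lemma le_conjugate (R : realType) (n : nat) (h : 'cV[R]_n -> \bar R) x y :
  (-oo < h x)%E -> (- convex_conjugate h y <= h x - (dotp x y)%:E)%E.
Proof.
move=> hx; have : ((dotp x y)%:E - h x <= convex_conjugate h y)%E.
  by apply: ereal_sup_ubound; exists x.
rewrite -leeN2 => /le_trans; apply.
by case: (h x) hx => [a| |]//= _; rewrite ?leey// lee_fin; lra.
Qed.

Lemma conjugate_le (R : realType) (n : nat) (h : 'cV[R]_n -> \bar R) v y (a : R) :
  (forall x, ((a + dotp (x - v) y)%:E <= h x)%E) ->
  ((a - dotp v y)%:E <= - convex_conjugate h y)%E.
Proof.
move=> hle; rewrite leeNr; apply: ge_ereal_sup => _ [x _ <-].
have := hle x; case: (h x) => [b| |]//=; rewrite ?lee_fin ?dotpBl; last by rewrite leNye.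
by lra.
Qed.

Section duality.
Context {R : realType} {nx nz T : nat}.
Variables (f : 'I_T.+1 -> 'cV[R]_nx -> \bar R) (g : 'I_T.+1 -> 'cV[R]_nz -> \bar R).
Variables (F : 'I_T -> 'M[R]_nx) (H : 'I_T.+1 -> 'M[R]_(nz, nx)).
Variable z : 'I_T.+1 -> 'cV[R]_nz.

Local Notation X := {ffun 'I_T.+1 -> 'cV[R]_nx}.
Local Notation V := {ffun 'I_T.+1 -> 'cV[R]_nx * 'cV[R]_nz}.

Definition noise (x : 'I_T.+1 -> 'cV[R]_nx) (t : 'I_T.+1) : 'cV[R]_nx :=
  if unlift ord0 t is Some s then x t - F s *m x (now s) else x t.

(** The adjoint of [noise]. There the index [s] stands for the time before [t], here for [t] itself;
    the exceptional time is accordingly the last one instead of the first. *)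
Definition costate (y : 'I_T.+1 -> 'cV[R]_nx) (t : 'I_T.+1) : 'cV[R]_nx :=
  if unlift ord_max t is Some s then y t - (F s)^T *m y (next s) else y t.

Definition pairing (y : 'I_T.+1 -> 'cV[R]_nx) (u : 'I_T.+1 -> 'cV[R]_nz) (v : V) : R :=
  \sum_t (dotp (v t).1 (y t) + dotp (v t).2 (u t)).

Definition cost (v : V) : \bar R := (\sum_t (f t (v t).1 + g t (v t).2))%E.

(* (P) minimises [cost] over the affine subspace [offset + trajectory x]. *)
Definition trajectory (x : X) : V := [ffun t => (noise x t, - (H t *m x t))].
Definition offset : V := [ffun t => (0, z t)].

Lemma now_lift (s : 'I_T) : now s = lift ord_max s.
Proof. by apply/val_inj; rewrite /= /bump leqNgt ltn_ord. Qed.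

Lemma noise0 x : noise x ord0 = x ord0.
Proof. by rewrite /noise unlift_none. Qed.

Lemma noise_next x s : noise x (next s) = x (next s) - F s *m x (now s).
Proof. by rewrite /noise liftK. Qed.

Lemma costate_max y : costate y ord_max = y ord_max.
Proof. by rewrite /costate unlift_none. Qed.

Lemma costate_now y s : costate y (now s) = y (now s) - (F s)^T *m y (next s).
Proof. by rewrite /costate now_lift liftK. Qed.

Lemma P_constraintsE x w : P_constraints F x w <-> w = noise x.
Proof.
split=> [[xw x0]|->].
  apply/funext => t; case: (unliftP ord0 t) => [s|] ->; last by rewrite noise0.
  by rewrite noise_next xw addrC addKr.
split=> [t|]; last by rewrite noise0.
by rewrite noise_next addrC subrK.
Qed.

Lemma D_constraintsE u y :
  D_constraints F H u y <-> forall t, costate y t = (H t)^T *m u t.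
Proof.
split=> [[yu yT] t|yu].
  case: (unliftP ord_max t) => [s|] ->; last by rewrite costate_max.
  by rewrite -now_lift costate_now yu addrC addKr.
split=> [t|]; last by rewrite -yu costate_max.
by rewrite -yu costate_now addrC subrK.
Qed.

(** Summation by parts: the unpaired terms are [x] at time 0 on one side and [y] at the final time
    on the other. *)
Lemma noise_adjoint (x y : 'I_T.+1 -> 'cV[R]_nx) :
  \sum_t dotp (noise x t) (y t) = \sum_t dotp (x t) (costate y t).
Proof.
rewrite big_ord_recl noise0.
under eq_bigr => s _ do rewrite (noise_next x s) dotpBl dotp_mulmxl.
rewrite sumrB addrA -(big_ord_recl _ (fun t => dotp (x t) (y t))).
rewrite [RHS]big_ord_recr /= costate_max.
under [in RHS]eq_bigr => s _ do rewrite (costate_now y s) dotpBr.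
by rewrite sumrB addrAC -(big_ord_recr _ (fun t => dotp (x t) (y t))).
Qed.

Lemma pairing_trajectory y u (x : X) :
  pairing y u (trajectory x) = \sum_t dotp (x t) (costate y t - (H t)^T *m u t).
Proof.
rewrite /pairing; under eq_bigr do rewrite ffunE /= dotpNl dotp_mulmxl.
rewrite big_split /= noise_adjoint -big_split; apply: eq_bigr => t _ /=.
by rewrite dotpBr.
Qed.

(** This identifies (D) as the Fenchel dual of (P). For the converse, the form is tested on the
    trajectory of the residuals [costate y t - (H t)^T *m u t], where it is a sum of squares. *)
Lemma D_constraintsP u y :
  D_constraints F H u y <-> forall x, pairing y u (trajectory x) = 0.
Proof.
split=> [/D_constraintsE yu x|yu].
  by rewrite pairing_trajectory big1// => t _; rewrite yu subrr dotpC dotp0l.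
apply/D_constraintsE => t; apply/subr0_eq/dotp_eq0/eqP.
have /eqP := yu [ffun t => costate y t - (H t)^T *m u t].
rewrite pairing_trajectory; under eq_bigr do rewrite ffunE.
rewrite psumr_eq0 => [/allP|s _]; last exact: dotp_ge0.
by move=> /(_ t (mem_index_enum _)).
Qed.

Lemma pairingZ s y u v :
  pairing (fun t => s *: y t) (fun t => s *: u t) v = s * pairing y u v.
Proof.
by rewrite /pairing mulr_sumr; apply: eq_bigr => t _; rewrite !dotpZr mulrDr.
Qed.

Lemma scalar_pairing (p : V -> R) : scalar p -> exists y u, p = pairing y u.
Proof.
move=> /scalar_bundle[{}p ->].
pose e t (a : 'cV[R]_nx * 'cV[R]_nz) : V := [ffun t' => if t' == t then a else 0].
have le t : linear (e t).
  move=> s a b; apply/ffunP => t'; rewrite !ffunE.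
  by case: eqP => // _; rewrite scaler0 addr0.
have /boolp.choice[y yE] t : exists c, forall a, p (e t (a, 0)) = dotp a c.
  apply: (@scalar_col _ _ (fun a => p (e t (a, 0)))) => s a b.
  have -> : (s *: a + b, 0) = s *: (a, 0) + (b, 0) :> 'cV[R]_nx * 'cV[R]_nz.
    by congr pair; rewrite /= ?scaler0 ?addr0.
  by rewrite le linearP.
have /boolp.choice[u uE] t : exists c, forall a, p (e t (0, a)) = dotp a c.
  apply: (@scalar_col _ _ (fun a => p (e t (0, a)))) => s a b.
  have -> : (0, s *: a + b) = s *: (0, a) + (0, b) :> 'cV[R]_nx * 'cV[R]_nz.
    by congr pair; rewrite /= ?scaler0 ?addr0.
  by rewrite le linearP.
exists y, u; apply/funext => v.
have vE : v = \sum_t (e t ((v t).1, 0) + e t (0, (v t).2)).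
  apply/ffunP => t; rewrite sum_ffunE (bigD1 t)//= big1 => [|s /negPf st].
    rewrite !ffunE eqxx addr0; case: (v t) => a b /=.
    by congr pair; rewrite /= ?addr0 ?add0r.
  by rewrite !ffunE eq_sym st addr0.
by rewrite [in LHS]vE linear_sum; apply: eq_bigr => t _; rewrite linearD yE uE.
Qed.

Lemma pairing_scalar (y : 'I_T.+1 -> 'cV[R]_nx) (u : 'I_T.+1 -> 'cV[R]_nz) :
  scalar (pairing y u).
Proof.
move=> s v w; rewrite /pairing /= mulr_sumr -big_split; apply: eq_bigr => t _ /=.
by rewrite !ffunE /= (dotp_scalar (y t) s) (dotp_scalar (u t) s) /=; ring.
Qed.

Lemma linear_trajectory : linear trajectory.
Proof.
move=> s x x'; apply/ffunP => t; rewrite !ffunE; congr pair => /=; last first.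
  by rewrite mulmxDr -scalemxAr opprD scalerN.
rewrite /noise; case: unlift => [r|]; rewrite !ffunE//.
by rewrite mulmxDr -scalemxAr scalerBr opprD addrACA.
Qed.

Lemma P_objectiveE x w : P_constraints F x w ->
  P_objective f g H z x w = cost (offset + trajectory (finfun x)).
Proof.
move=> /P_constraintsE ->; rewrite /P_objective -big_split; apply: eq_bigr => t _.
have xE : (finfun x : X) = x :> ('I_T.+1 -> 'cV[R]_nx).
  by apply/funext => s; rewrite ffunE.
by rewrite !ffunE /= add0r xE.
Qed.

Lemma weak_duality u y (x : X) :
  (forall t a, -oo < f t a)%E -> (forall t a, -oo < g t a)%E ->
  D_constraints F H u y ->
  (D_objective f g z u y <= cost (offset + trajectory x)%R)%E.
Proof.
move=> fNy gNy /D_constraintsP yu; set v := offset + _.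
have [p pE] := scalar_bundle (pairing_scalar y u).
have pv : pairing y u v = pairing y u offset by rewrite /v pE linearD -pE yu addr0.
(* The added real terms sum to [pairing y u offset - pairing y u v], which is 0. *)
suff -> : cost v = (\sum_t (f t (v t).1 + g t (v t).2
    + (dotp (z t) (u t) - dotp (v t).1 (y t) - dotp (v t).2 (u t))%:E))%E.
  apply: lee_sum => t _.
  have := leeD (le_conjugate (y t) (fNy t (v t).1)) (le_conjugate (u t) (gNy t (v t).2)).
  move=> /(leeD2l (dotp (z t) (u t))%:E); rewrite addeA => /le_trans; apply.
  have := fNy t (v t).1; have := gNy t (v t).2.
  case: (f t _) (g t _) => [a| |] [b| |]//= _ _; rewrite lee_fin; lra.
rewrite big_split /= sumEFin; set r := (X in X%:E); suff -> : r = 0 by rewrite adde0.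
move/eqP: pv; rewrite eq_sym -subr_eq0 /pairing -sumrB => /eqP pv.
rewrite -[RHS]pv; apply: eq_bigr => t _; rewrite !ffunE /= dotp0l; lra.
Qed.

(** The constants [a t] and [b t] need not be values at [v]. Values together with subgradients close
    the duality gap; uniform lower bounds together with a normal to the domain show that (D) is
    unbounded. *)
Lemma D_objective_ge y u (v : V) (a b : 'I_T.+1 -> R) :
  (forall t x, (a t + dotp (x - (v t).1) (y t))%:E <= f t x)%E ->
  (forall t x, (b t + dotp (x - (v t).2) (u t))%:E <= g t x)%E ->
  ((\sum_t (a t + b t) + pairing y u (offset - v))%:E <= D_objective f g z u y)%E.
Proof.
move=> fge gge; rewrite /pairing -big_split -sumEFin; apply: lee_sum => t _ /=.
have := leeD (conjugate_le (fge t)) (conjugate_le (gge t)).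
move=> /(leeD2l (dotp (z t) (u t))%:E) dualle; rewrite -addeA; apply: le_trans dualle.
by rewrite -!EFinD lee_fin !ffunE /= !dotpBl dotp0l; lra.
Qed.

(** Changing [v] in one component at one time splits an inequality on [cost] into separate ones for
    each [f t] and [g t]. *)
Definition set_fst (v : V) t a : V := [ffun s => if s == t then (a, (v s).2) else v s].
Definition set_snd (v : V) t b : V := [ffun s => if s == t then ((v s).1, b) else v s].

Lemma pairing_set_fst y u (v : V) t a :
  pairing y u (set_fst v t a - v) = dotp (a - (v t).1) (y t).
Proof.
rewrite /pairing (bigD1 t)//= big1 => [|s /negPf st].
  by rewrite !ffunE eqxx /= subrr dotp0l !addr0.
by rewrite !ffunE st subrr /= !dotp0l addr0.
Qed.

Lemma pairing_set_snd y u (v : V) t b :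
  pairing y u (set_snd v t b - v) = dotp (b - (v t).2) (u t).
Proof.
rewrite /pairing (bigD1 t)//= big1 => [|s /negPf st].
  by rewrite !ffunE eqxx /= subrr dotp0l add0r addr0.
by rewrite !ffunE st subrr /= !dotp0l addr0.
Qed.

Section finite_cost.
Variables (v : V) (a b : 'I_T.+1 -> R).
Hypothesis fv : forall t, f t (v t).1 = (a t)%:E.
Hypothesis gv : forall t, g t (v t).2 = (b t)%:E.

Lemma cost_fin : cost v = (\sum_t (a t + b t))%:E.
Proof. by rewrite /cost -sumEFin; apply: eq_bigr => t _; rewrite fv gv. Qed.

Lemma cost_set_fst t x :
  cost (set_fst v t x) = (f t x + (\sum_s (a s + b s) - a t)%:E)%E.
Proof.
have sumE : \sum_s (a s + b s) = a t + b t + \sum_(s | s != t) (a s + b s).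
  by rewrite (bigD1 t).
rewrite /cost (bigD1 t)//= ffunE eqxx /= gv.
rewrite (eq_bigr (fun s => (a s + b s)%:E)) => [|s /negPf st].
  by rewrite sumEFin sumE -addeA -EFinD; congr (_ + _%:E)%E; lra.
by rewrite ffunE st fv gv.
Qed.

Lemma cost_set_snd t x :
  cost (set_snd v t x) = (g t x + (\sum_s (a s + b s) - b t)%:E)%E.
Proof.
have sumE : \sum_s (a s + b s) = a t + b t + \sum_(s | s != t) (a s + b s).
  by rewrite (bigD1 t).
rewrite /cost (bigD1 t)//= ffunE eqxx /= fv.
rewrite (eq_bigr (fun s => (a s + b s)%:E)) => [|s /negPf st].
  by rewrite sumEFin sumE (addeC (a t)%:E) -addeA -EFinD; congr (_ + _%:E)%E; lra.
by rewrite ffunE st fv gv.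
Qed.

End finite_cost.

Hypothesis f_density : forall t, log_concave_density (f t).
Hypothesis g_density : forall t, log_concave_density (g t).
Hypothesis f_plq : forall t, piecewise_linear_quadratic (f t).
Hypothesis g_plq : forall t, piecewise_linear_quadratic (g t).

Let fNy t x : (-oo < f t x)%E. Proof. by have [+ _ _ _] := f_density t; apply. Qed.
Let gNy t x : (-oo < g t x)%E. Proof. by have [+ _ _ _] := g_density t; apply. Qed.

Let affine_fst t : affine_map (fun v : V => (v t).1).
Proof.
by exists (fun v : V => (v t).1) => [s v w|]; [rewrite !ffunE|exists 0 => v; rewrite addr0].
Qed.

Let affine_snd t : affine_map (fun v : V => (v t).2).
Proof.
by exists (fun v : V => (v t).2) => [s v w|]; [rewrite !ffunE|exists 0 => v; rewrite addr0].
Qed.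

Lemma plq_cost : plq cost.
Proof.
apply: plq_sum => t; apply: plqD.
- exact: (plq_comp (piecewise_linear_quadratic_plq (f_plq t)) (affine_fst t)).
- exact: (plq_comp (piecewise_linear_quadratic_plq (g_plq t)) (affine_snd t)).
Qed.

Lemma convexe_cost : convexe cost.
Proof.
apply: convexe_sum => [t v|t].
  have := fNy t (v t).1; have := gNy t (v t).2.
  by case: (f t _) (g t _) => [a| |] [b| |]//= _ _; rewrite ltNyr.
apply: convexeD => //.
- have [_ + _ _] := f_density t => /convex_efun_convexe cf.
  exact: (convexe_comp cf (affine_fst t)).
- have [_ + _ _] := g_density t => /convex_efun_convexe cg.
  exact: (convexe_comp cg (affine_snd t)).
Qed.

Lemma cost_lty (v : V) : (cost v < +oo)%E ->
  forall t, (f t (v t).1 < +oo)%E /\ (g t (v t).2 < +oo)%E.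
Proof.
move=> cv t.
have nNy s : (f s (v s).1 + g s (v s).2 != -oo)%E.
  have := fNy s (v s).1; have := gNy s (v s).2.
  by case: (f s _) (g s _) => [a| |] [b| |].
have : (f t (v t).1 + g t (v t).2 < +oo)%E.
  rewrite ltNge leye_eq; apply: contraTN cv => /eqP ty.
  rewrite -leNgt leye_eq; apply/eqP/esum_eqyP => [s _|]; first exact: nNy.
  by exists t; split; rewrite ?mem_index_enum.
have := fNy t (v t).1; have := gNy t (v t).2.
by case: (f t _) (g t _) => [a| |] [b| |]//= _ _ _; rewrite !ltry.
Qed.

Lemma cost_ltyP (v : V) : (cost v < +oo)%E ->
  exists a b : 'I_T.+1 -> R, (forall t, f t (v t).1 = (a t)%:E) /\
    (forall t, g t (v t).2 = (b t)%:E).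
Proof.
move=> /cost_lty vt.
exists (fun t => fine (f t (v t).1)), (fun t => fine (g t (v t).2)); split => t.
  by rewrite fineK// fin_numElt fNy; have [] := vt t.
by rewrite fineK// fin_numElt gNy; have [] := vt t.
Qed.

Let lower_bounds : exists a b : 'I_T.+1 -> R,
  (forall t x, (a t)%:E <= f t x)%E /\ (forall t x, (b t)%:E <= g t x)%E.
Proof.
have /boolp.choice[a fa] : forall t, exists M : R, forall x, (M%:E <= f t x)%E.
  by move=> t; apply: log_concave_density_bounded_below.
have /boolp.choice[b gb] : forall t, exists M : R, forall x, (M%:E <= g t x)%E.
  by move=> t; apply: log_concave_density_bounded_below.
by exists a, b.
Qed.

Lemma strong_duality_feasible (x0 : X) : (cost (offset + trajectory x0)%R < +oo)%E ->
  exists (x : X) u y, [/\ D_constraints F H u y,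
    forall x', (cost (offset + trajectory x)%R <= cost (offset + trajectory x')%R)%E,
    cost (offset + trajectory x) \is a fin_num &
    D_objective f g z u y = cost (offset + trajectory x)].
Proof.
move=> cx0; have [m [n [fm gn]]] := lower_bounds.
have tr_aff : affine_map (fun x : X => offset + trajectory x).
  by exists trajectory; [exact: linear_trajectory|exists offset => x; rewrite addrC].
have [|x xmin] := plq_min (M := \sum_t (m t + n t)) (plq_comp plq_cost tr_aff) cx0.
  by move=> x /=; rewrite -sumEFin; apply: lee_sum => t _; rewrite EFinD leeD.
have {xmin} /= xmin := xmin.
set v := offset + trajectory x in xmin.
have cv : (cost v < +oo)%E by exact: le_lt_trans (xmin x0) cx0.
have [a [b [fa gb]]] := cost_ltyP cv.
have [|p [/scalar_pairing[y [u ->]] pL psub]] := @subgradient_exists _ _ _ cost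
    trajectory v linear_trajectory plq_cost convexe_cost cv.
  move=> x'; rewrite /v -addrA.
  have := linear_trajectory 1 x' x; rewrite !scale1r addrC => <-.
  exact: xmin.
have yu : D_constraints F H u y by exact/D_constraintsP.
exists x, u, y; split => //; first by rewrite (cost_fin fa gb).
apply/eqP; rewrite eq_le weak_duality//=.
rewrite -/v (cost_fin fa gb).
have fge t w : ((a t + dotp (w - (v t).1) (y t))%:E <= f t w)%E.
  have := psub (set_fst v t w).
  rewrite (cost_fin fa gb) pairing_set_fst (cost_set_fst fa gb).
  have := fNy t w; case: (f t w) => [c| |]//= _; rewrite ?leey// !lee_fin; lra.
have gge t w : ((b t + dotp (w - (v t).2) (u t))%:E <= g t w)%E.
  have := psub (set_snd v t w).
  rewrite (cost_fin fa gb) pairing_set_snd (cost_set_snd fa gb).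
  have := gNy t w; case: (g t w) => [c| |]//= _; rewrite ?leey// !lee_fin; lra.
(* The lower bound is [cost v], because [offset - v] is minus a trajectory, on which the form
   vanishes. *)
have := D_objective_ge fge gge; have [q qE] := scalar_bundle (pairing_scalar y u).
suff -> : pairing y u (offset - v) = 0 by rewrite addr0.
by rewrite /v opprD addNKr qE linearN -qE pL oppr0.
Qed.

Lemma dual_unbounded : (forall x : X, cost (offset + trajectory x) = +oo%E) ->
  D_value f g F H z = +oo%E.
Proof.
move=> infeasible.
have [v0 cv0] : exists v0 : V, (cost v0 < +oo)%E.
  have /boolp.choice[x fx] t := log_concave_density_proper (f_density t).
  have /boolp.choice[w gw] t := log_concave_density_proper (g_density t).
  exists [ffun t => (x t, w t)].
  rewrite (@cost_fin _ (fun t => fine (f t (x t))) (fun t => fine (g t (w t))))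
    ?ltry// => t; rewrite ffunE fineK// fin_numElt ?fx ?gw ?fNy ?gNy//.
have [p [v [/scalar_pairing[y [u ->]] pL cv psub pv]]] :=
  strict_separation linear_trajectory plq_cost convexe_cost cv0 infeasible.
have [q qE] := scalar_bundle (pairing_scalar y u).
have [a [b [fa gb]]] := cost_ltyP cv.
have [m [n [fm gn]]] := lower_bounds.
(* The separation gap; it is the guaranteed growth rate of the dual objective along the multiples of
   [(y, u)]. *)
pose d := pairing y u (offset - v).
have d0 : 0 < d by rewrite /d qE linearB -qE subr_gt0.
have ray s : 0 <= s -> ((\sum_t (m t + n t) + s * d)%:E <= D_value f g F H z)%E.
  move=> s0; rewrite -pairingZ.
  apply: (@le_trans _ _
    (D_objective f g z (fun t => s *: u t) (fun t => s *: y t))); last first.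
    apply: ereal_sup_ubound; exists (fun t => s *: u t), (fun t => s *: y t).
    by split => //; apply/D_constraintsP => x; rewrite pairingZ pL mulr0.
  apply: D_objective_ge => t w; rewrite dotpZr.
  - have [fw|] := ltP (f t w) +oo%E; last by rewrite leye_eq => /eqP ->; rewrite leey.
    apply: le_trans (fm t w); rewrite lee_fin gerDl mulr_ge0_le0//.
    rewrite -(pairing_set_fst y u v) qE linearB -qE subr_le0 psub//.
    rewrite (cost_set_fst fa gb); move: (@fNy t w) fw.
    by case: (f t w) => // c _ _; rewrite -EFinD ltry.
  - have [gw|] := ltP (g t w) +oo%E; last by rewrite leye_eq => /eqP ->; rewrite leey.
    apply: le_trans (gn t w); rewrite lee_fin gerDl mulr_ge0_le0//.
    rewrite -(pairing_set_snd y u v) qE linearB -qE subr_le0 psub//.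
    rewrite (cost_set_snd fa gb); move: (@gNy t w) gw.
    by case: (g t w) => // c _ _; rewrite -EFinD ltry.
have := ray 0 (lexx _); rewrite mul0r addr0.
case: (D_value f g F H z) ray => [r ray|//|//]; rewrite lee_fin => Sr.
(* At this [s] the lower bound equals [r + 1], which contradicts a finite dual value [r]. *)
have s0 : 0 <= (r - \sum_t (m t + n t) + 1) / d.
  by rewrite divr_ge0 ?(ltW d0)// addr_ge0// subr_ge0.
by have := ray _ s0; rewrite divfK ?gt_eqF// lee_fin addrA subrKC gerDl ler10.
Qed.

End duality.

Theorem theorem2p7 (R : realType) (nx nz T : nat)
    (f : 'I_T.+1 -> 'cV[R]_nx -> \bar R) (g : 'I_T.+1 -> 'cV[R]_nz -> \bar R)
    (F : 'I_T -> 'M[R]_nx) (H : 'I_T.+1 -> 'M[R]_(nz, nx))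
    (z : 'I_T.+1 -> 'cV[R]_nz)
    (f_density : forall t, log_concave_density (f t))
    (g_density : forall t, log_concave_density (g t))
    (f_plq : forall t, piecewise_linear_quadratic (f t))
    (g_plq : forall t, piecewise_linear_quadratic (g t))
    (feasible : P_feasible f g F H z \/ D_feasible f g F H z) :
  [/\ P_value f g F H z = D_value f g F H z,
      P_attained f g F H z &
      (D_value f g F H z \is a fin_num -> D_attained f g F H z)].
Proof.
have fNy t x : (-oo < f t x)%E by have [+ _ _ _] := f_density t; apply.
have gNy t x : (-oo < g t x)%E by have [+ _ _ _] := g_density t; apply.
have ffunK (x : {ffun 'I_T.+1 -> 'cV[R]_nx}) : finfun x = x by apply/ffunP => t; rewrite ffunE.
have [[x0 cx0]|infeasible] := pselect (exists x,
    (cost f g (offset z + trajectory F H x)%R < +oo)%E).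
  have [x [u [y [yu xmin _ duE]]]] :=
    strong_duality_feasible f_density g_density f_plq g_plq cx0.
  have xw : P_constraints F x (noise F x) by exact/P_constraintsE.
  have Px : P_objective f g H z x (noise F x) = cost f g (offset z + trajectory F H x).
    by rewrite (P_objectiveE f g H z xw) ffunK.
  have PE : P_value f g F H z = cost f g (offset z + trajectory F H x).
    apply/eqP; rewrite eq_le; apply/andP; split.
      by apply: ereal_inf_lbound; exists x, (noise F x); rewrite Px.
    apply: le_ereal_inf_tmp => _ [x' [w' [xw' ->]]].
    by rewrite (P_objectiveE f g H z xw') xmin.
  have DE : D_value f g F H z = cost f g (offset z + trajectory F H x).
    apply/eqP; rewrite eq_le; apply/andP; split.
      by apply: ge_ereal_sup => _ [u' [y' [yu' ->]]]; exact: weak_duality.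
    by rewrite -duE; apply: ereal_sup_ubound; exists u, y.
  split; first by rewrite PE DE.
    by exists x, (noise F x); rewrite Px PE.
  by move=> _; exists u, y; rewrite duE DE.
have costy x : cost f g (offset z + trajectory F H x) = +oo%E.
  by apply/eqP; rewrite -leye_eq leNgt; apply/negP => cx; apply: infeasible; exists x.
have PE : P_value f g F H z = +oo%E.
  apply/eqP; rewrite -leye_eq; apply: le_ereal_inf_tmp => _ [x [w [xw ->]]].
  by rewrite (P_objectiveE f g H z xw) costy.
have DE := dual_unbounded f_density g_density f_plq g_plq costy.
(* Both values are +oo: every trajectory attains the one of (P), in particular the zero trajectory,
   and the implication for (D) is vacuous. *)
split; rewrite ?PE ?DE//.
have xw : P_constraints F (fun=> 0) (noise F (fun=> 0)) by exact/P_constraintsE.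
by exists (fun=> 0), (noise F (fun=> 0)); rewrite (P_objectiveE f g H z xw) costy PE.
Qed.
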